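(* The index set $\{ e: \mathcal{C}_e \text{ has degree of bi-embeddable categoricity } \mathbf{0}'\}$ is $\Sigma^0_4$-complete.
   Context: An equivalence structure $\mathcal{A}=(A,E)$ has universe $A\subseteq\omega$ and an equivalence relation $E$ on $A$; it is computable if its atomic diagram is computable. Two structures are bi-embeddable if each embeds into the other. The degree of bi-embeddable categoricity of a computable structure $\mathcal{A}$ is the least Turing degree $\mathbf{d}$ (if it exists) such that for any two computable structures bi-embeddable with $\mathcal{A}$, $\mathbf{d}$ computes embeddings between them in both directions. $(\mathcal{C}_e)_{e\in\omega}$ is the enumeration of partial computable equivalence structures: for the $e$-th partial computable function $\phi_e:\omega\times\omega\to\{0,1\}$, $\mathcal{C}_e$ has universe $\omega$ and $x E^{\mathcal{C}_e} y$ iff $\phi_e(x,y)=1$. A set is $\Sigma^0_4$-complete if it is $\Sigma^0_4$ and every $\Sigma^0_4$ set is many-one reducible to it via a computable function. *)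

(* Defs.v *)
From Stdlib Require Import Arith Cantor.

Definition pair (x y : nat) : nat := Cantor.to_nat (x, y).
Definition fst' (n : nat) : nat := fst (Cantor.of_nat n).
Definition snd' (n : nat) : nat := snd (Cantor.of_nat n).

(* Programs: unary oracle mu-recursive functions (multi-argument
   functions are handled through Cantor pairing). *)
Inductive code : Type :=
| CZero
| CSucc
| CId
| CFst
| CSnd
| COracle
| CComp (f g : code)
| CPair (f g : code)
| CRec (f g : code)
| CMu (f : code).

Definition oracle := nat -> Prop.

Inductive eval (O : oracle) : code -> nat -> nat -> Prop :=
| ev_zero x : eval O CZero x 0
| ev_succ x : eval O CSucc x (S x)
| ev_id x : eval O CId x x
| ev_fst x : eval O CFst x (fst' x)
| ev_snd x : eval O CSnd x (snd' x)
| ev_or1 x : O x -> eval O COracle x 1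
| ev_or0 x : ~ O x -> eval O COracle x 0
| ev_comp f g x y z : eval O g x y -> eval O f y z -> eval O (CComp f g) x z
| ev_pair f g x y z : eval O f x y -> eval O g x z -> eval O (CPair f g) x (pair y z)
| ev_rec0 f g x y : eval O f x y -> eval O (CRec f g) (pair x 0) y
| ev_recS f g x n y z :
    eval O (CRec f g) (pair x n) y -> eval O g (pair (pair x n) y) z ->
    eval O (CRec f g) (pair x (S n)) z
| ev_mu f x y :
    eval O f (pair x y) 0 ->
    (forall z, z < y -> exists v, v <> 0 /\ eval O f (pair x z) v) ->
    eval O (CMu f) x y.

(* Goedel numbering: a surjective decoding nat -> code. *)
Fixpoint decode_aux (fuel n : nat) : code :=
  match fuel with
  | 0 => CZero
  | S fuel' =>
    let k := n / 10 in
    let a := fst' k in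
    let b := snd' k in
    match n mod 10 with
    | 0 => CZero
    | 1 => CSucc
    | 2 => CId
    | 3 => CFst
    | 4 => CSnd
    | 5 => COracle
    | 6 => CComp (decode_aux fuel' a) (decode_aux fuel' b)
    | 7 => CPair (decode_aux fuel' a) (decode_aux fuel' b)
    | 8 => CRec (decode_aux fuel' a) (decode_aux fuel' b)
    | _ => CMu (decode_aux fuel' k)
    end
  end.
Definition decode (e : nat) : code := decode_aux e e.

Definition Phi (O : oracle) (e x y : nat) : Prop := eval O (decode e) x y.

Definition empty_oracle : oracle := fun _ => False.
Definition phi (e x y : nat) : Prop := Phi empty_oracle e x y.

Definition O_decidable (O : oracle) (A : nat -> Prop) : Prop :=
  exists p : code, forall n,
    (A n /\ eval O p n 1) \/ (~ A n /\ eval O p n 0).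
Definition decidable_set (A : nat -> Prop) : Prop := O_decidable empty_oracle A.

Definition turing_le (A B : nat -> Prop) : Prop := O_decidable B A.

Definition halting_set : nat -> Prop := fun e => exists y, phi e e y.

Definition Sigma0_4 (S : nat -> Prop) : Prop :=
  exists R : nat -> Prop, decidable_set R /\
    forall n, S n <-> exists a, forall b, exists c, forall d,
        R (pair n (pair a (pair b (pair c d)))).

Definition computable_fun (f : nat -> nat) : Prop :=
  exists p : code, forall n, eval empty_oracle p n (f n).

Definition many_one_le (T S : nat -> Prop) : Prop :=
  exists f, computable_fun f /\ forall n, T n <-> S (f n).

Definition Sigma0_4_complete (S : nat -> Prop) : Prop :=
  Sigma0_4 S /\ forall T, Sigma0_4 T -> many_one_le T S.

Record eq_struct : Type := EqStruct {
  es_univ : nat -> Prop;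
  es_rel : nat -> nat -> Prop }.

Definition is_equivalence_structure (M : eq_struct) : Prop :=
  (forall x, es_univ M x -> es_rel M x x) /\
  (forall x y, es_univ M x -> es_univ M y -> es_rel M x y -> es_rel M y x) /\
  (forall x y z, es_univ M x -> es_univ M y -> es_univ M z ->
     es_rel M x y -> es_rel M y z -> es_rel M x z).

Definition computable_eq_struct (M : eq_struct) : Prop :=
  is_equivalence_structure M /\
  decidable_set (es_univ M) /\
  decidable_set (fun n => es_rel M (fst' n) (snd' n)).

Definition is_embedding (M N : eq_struct) (f : nat -> nat) : Prop :=
  (forall x, es_univ M x -> es_univ N (f x)) /\
  (forall x y, es_univ M x -> es_univ M y -> f x = f y -> x = y) /\
  (forall x y, es_univ M x -> es_univ M y ->
     (es_rel M x y <-> es_rel N (f x) (f y))).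

Definition embeds (M N : eq_struct) : Prop := exists f, is_embedding M N f.
Definition bi_embeddable (M N : eq_struct) : Prop := embeds M N /\ embeds N M.

Definition O_computable_embedding (O : oracle) (M N : eq_struct) : Prop :=
  exists (p : code) (f : nat -> nat),
    (forall x, es_univ M x -> eval O p x (f x)) /\ is_embedding M N f.

Definition bi_emb_cat_for (O : oracle) (M : eq_struct) : Prop :=
  forall B C : eq_struct,
    computable_eq_struct B -> computable_eq_struct C ->
    bi_embeddable B M -> bi_embeddable C M ->
    O_computable_embedding O B C /\ O_computable_embedding O C B.

Definition has_bi_emb_cat_degree (M : eq_struct) (X : oracle) : Prop :=
  bi_emb_cat_for X M /\
  forall Y : oracle, bi_emb_cat_for Y M -> turing_le X Y.

Definition C (e : nat) : eq_struct :=
  EqStruct (fun _ => True) (fun x y => phi e (pair x y) 1).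

Definition C_is_structure (e : nat) : Prop :=
  (forall x y, exists v, phi e (pair x y) v) /\ is_equivalence_structure (C e).

(* Main.v *)
(* A computable equivalence structure has degree 0' iff it has only finitely many
   infinite classes and, for every m, infinitely many classes of size at least m.
   Then 0' bounds the sizes of the finite classes, hence computes embeddings; and 0'
   is computed by any embedding of a structure whose n-th class grows when n enters
   the halting set into one whose n-th class has size n + 1. With infinitely many
   infinite classes, a Post-style simple set relative to 0' gives a structure in
   which 0' cannot list infinitely many infinite classes. In the remaining case
   embeddings can be found computably. For hardness, given a set defined by
   exists a, forall b, exists c, forall d, R, a class is attached to each a and each
   potential least witness that all a' <= a fail; it is infinite iff the witness is
   correct. *)
From Stdlib Require Import Arith Cantor Lia List Bool Classical ClassicalEpsilon.
From Stdlib Require Import FunctionalExtensionality PropExtensionality.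
Require Import Defs.
Import ListNotations.

(** Only class sizes matter for embeddings: any assignment of classes that is injective and never
    decreases size is realised by matching elements in order. So computing an embedding means
    finding fresh, large enough target classes, and the finitely many classes that escape this
    search can be tabulated from some given embedding. If some [m] has only finitely many classes of
    size at least [m], take it least: almost all classes then have fewer than [m] elements, and
    infinitely many classes of size at least [m - 1] are available as targets.

    In the coding of 0', a growing finite class might be sent to an infinite one and reveal nothing.
    This is excluded because both structures have the same finite number of infinite classes, all of
    them needed for the infinite classes of the source.

    In the hardness proof a single good [a] must leave only finitely many infinite classes although
    later [a'] may fail. This is why failure is required of all [a' <= a] at once, and why
    leastness, which allows one infinite class per [a], is essential.

    Programs are run by a stack machine because both the limit lemma and the quantifier count need
    evaluation with a decidable step bound. *)

Lemma fst_pair (x y : nat) : fst' (pair x y) = x.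
Proof. unfold fst', pair; now rewrite cancel_of_to. Qed.

Lemma snd_pair (x y : nat) : snd' (pair x y) = y.
Proof. unfold snd', pair; now rewrite cancel_of_to. Qed.

Lemma pair_eta (n : nat) : pair (fst' n) (snd' n) = n.
Proof.
  unfold fst', snd', pair.
  now rewrite <- surjective_pairing, cancel_to_of.
Qed.

Lemma pair_ge (x y : nat) : x + y <= pair x y.
Proof. generalize (to_nat_non_decreasing x y); unfold pair; lia. Qed.

Lemma fst_le (n : nat) : fst' n <= n.
Proof. generalize (pair_ge (fst' n) (snd' n)); rewrite pair_eta; lia. Qed.

Lemma snd_le (n : nat) : snd' n <= n.
Proof. generalize (pair_ge (fst' n) (snd' n)); rewrite pair_eta; lia. Qed.

Lemma pair_inj (x y x' y' : nat) : pair x y = pair x' y' -> x = x' /\ y = y'.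
Proof.
  intros H; split.
  - now rewrite <- (fst_pair x y), H, fst_pair.
  - now rewrite <- (snd_pair x y), H, snd_pair.
Qed.

Global Opaque pair fst' snd'.

(* The automatically generated principle gives no induction hypothesis for the
   subcomputations hidden under the existential in [ev_mu]. *)
Section EvalInd.
Variables (O : oracle) (P : code -> nat -> nat -> Prop).
Hypotheses
  (Pzero : forall x, P CZero x 0)
  (Psucc : forall x, P CSucc x (S x))
  (Pid : forall x, P CId x x)
  (Pfst : forall x, P CFst x (fst' x))
  (Psnd : forall x, P CSnd x (snd' x))
  (Por1 : forall x, O x -> P COracle x 1)
  (Por0 : forall x, ~ O x -> P COracle x 0)
  (Pcomp : forall f g x y z, eval O g x y -> P g x y -> eval O f y z ->
     P f y z -> P (CComp f g) x z)
  (Ppair : forall f g x y z, eval O f x y -> P f x y -> eval O g x z ->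
     P g x z -> P (CPair f g) x (pair y z))
  (Prec0 : forall f g x y, eval O f x y -> P f x y -> P (CRec f g) (pair x 0) y)
  (PrecS : forall f g x n y z,
     eval O (CRec f g) (pair x n) y -> P (CRec f g) (pair x n) y ->
     eval O g (pair (pair x n) y) z -> P g (pair (pair x n) y) z ->
     P (CRec f g) (pair x (S n)) z)
  (Pmu : forall f x y,
     eval O f (pair x y) 0 -> P f (pair x y) 0 ->
     (forall z, z < y ->
        exists v, v <> 0 /\ eval O f (pair x z) v /\ P f (pair x z) v) ->
     P (CMu f) x y).

Fixpoint eval_strong_ind (c : code) (x y : nat) (H : eval O c x y) : P c x y :=
  match H in eval _ c x y return P c x y with
  | ev_zero _ x => Pzero x
  | ev_succ _ x => Psucc x
  | ev_id _ x => Pid x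
  | ev_fst _ x => Pfst x
  | ev_snd _ x => Psnd x
  | ev_or1 _ x h => Por1 x h
  | ev_or0 _ x h => Por0 x h
  | ev_comp _ f g x y z h1 h2 =>
      Pcomp f g x y z h1 (eval_strong_ind _ _ _ h1) h2 (eval_strong_ind _ _ _ h2)
  | ev_pair _ f g x y z h1 h2 =>
      Ppair f g x y z h1 (eval_strong_ind _ _ _ h1) h2 (eval_strong_ind _ _ _ h2)
  | ev_rec0 _ f g x y h => Prec0 f g x y h (eval_strong_ind _ _ _ h)
  | ev_recS _ f g x n y z h1 h2 =>
      PrecS f g x n y z h1 (eval_strong_ind _ _ _ h1) h2 (eval_strong_ind _ _ _ h2)
  | ev_mu _ f x y h1 h2 =>
      Pmu f x y h1 (eval_strong_ind _ _ _ h1)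
        (fun z hz => match h2 z hz with
          | ex_intro _ v (conj nz hv) =>
              ex_intro _ v (conj nz (conj hv (eval_strong_ind _ _ _ hv)))
          end)
  end.
End EvalInd.

(** * Computable functions *)

Definition Comp (O : oracle) (f : nat -> nat) : Prop :=
  exists p, forall n, eval O p n (f n).
Definition Comp2 (O : oracle) (F : nat -> nat -> nat) : Prop :=
  Comp O (fun z => F (fst' z) (snd' z)).
Definition Comp3 (O : oracle) (F : nat -> nat -> nat -> nat) : Prop :=
  Comp O (fun z => F (fst' (fst' z)) (snd' (fst' z)) (snd' z)).
Definition CompB (O : oracle) (b : nat -> bool) : Prop :=
  Comp O (fun n => Nat.b2n (b n)).
Definition CompB2 (O : oracle) (b : nat -> nat -> bool) : Prop :=
  Comp2 O (fun x y => Nat.b2n (b x y)).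
Definition CompB3 (O : oracle) (b : nat -> nat -> nat -> bool) : Prop :=
  Comp3 O (fun x y z => Nat.b2n (b x y z)).

Lemma comp_ext O f g : Comp O f -> (forall n, f n = g n) -> Comp O g.
Proof. intros [p Hp] E; exists p; intros n; rewrite <- E; auto. Qed.

Lemma comp_id O : Comp O (fun n => n).
Proof. exists CId; constructor. Qed.

Lemma comp_succ O f : Comp O f -> Comp O (fun n => S (f n)).
Proof. intros [p Hp]; exists (CComp CSucc p); econstructor; eauto; constructor. Qed.

Lemma comp_const O k : Comp O (fun _ => k).
Proof.
  induction k as [|k IH]; [exists CZero; constructor|].
  now apply (comp_succ O (fun _ => k)).
Qed.

Lemma comp_fst O f : Comp O f -> Comp O (fun n => fst' (f n)).
Proof. intros [p Hp]; exists (CComp CFst p); econstructor; eauto; constructor. Qed.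

Lemma comp_snd O f : Comp O f -> Comp O (fun n => snd' (f n)).
Proof. intros [p Hp]; exists (CComp CSnd p); econstructor; eauto; constructor. Qed.

Lemma comp_pair O f g : Comp O f -> Comp O g -> Comp O (fun n => pair (f n) (g n)).
Proof. intros [p Hp] [q Hq]; exists (CPair p q); econstructor; eauto. Qed.

Lemma comp_app O f g : Comp O f -> Comp O g -> Comp O (fun n => f (g n)).
Proof. intros [p Hp] [q Hq]; exists (CComp p q); econstructor; eauto. Qed.

Lemma comp_app2 O F f g :
  Comp2 O F -> Comp O f -> Comp O g -> Comp O (fun n => F (f n) (g n)).
Proof.
  intros HF Hf Hg.
  apply (comp_ext _ _ _ (comp_app O _ _ HF (comp_pair O _ _ Hf Hg))).
  intros n; now rewrite fst_pair, snd_pair.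
Qed.

Lemma comp_app3 O F f g h :
  Comp3 O F -> Comp O f -> Comp O g -> Comp O h ->
  Comp O (fun n => F (f n) (g n) (h n)).
Proof.
  intros HF Hf Hg Hh.
  apply (comp_ext _ _ _ (comp_app O _ _ HF
    (comp_pair O _ _ (comp_pair O _ _ Hf Hg) Hh))).
  intros n; now rewrite !fst_pair, !snd_pair.
Qed.

(** The value of [CRec] for a fixed parameter. Later recursions are written with it so that the
    tactic [comp] recognises them. *)
Fixpoint prec (a : nat) (g : nat -> nat -> nat) (n : nat) : nat :=
  match n with 0 => a | S k => g k (prec a g k) end.

Lemma comp_prec O f g h :
  Comp O f -> Comp3 O g -> Comp O h ->
  Comp O (fun n => prec (f n) (g n) (h n)).
Proof.
  intros [p Hp] [q Hq] [r Hr].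
  exists (CComp (CRec p q) (CPair CId r)); intros n.
  apply ev_comp with (pair n (h n)).
  { constructor; [constructor | auto]. }
  induction (h n) as [|k IH]; simpl.
  - constructor; auto.
  - econstructor; [exact IH|].
    specialize (Hq (pair (pair n k) (prec (f n) (g n) k))).
    now rewrite !fst_pair, !snd_pair in Hq.
Qed.

Lemma comp_pred O f : Comp O f -> Comp O (fun n => Nat.pred (f n)).
Proof.
  intros Hf.
  apply (comp_ext _ (fun n => prec 0 (fun k _ => k) (f n))).
  - apply (comp_prec O (fun _ => 0) (fun _ k _ => k)); auto using comp_const.
    apply (comp_snd O fst'), (comp_fst O (fun n => n)), comp_id.
  - intros n; destruct (f n); reflexivity.
Qed.

Lemma comp_sub O f g : Comp O f -> Comp O g -> Comp O (fun n => f n - g n).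
Proof.
  intros Hf Hg.
  apply (comp_ext _ (fun n => prec (f n) (fun _ r => Nat.pred r) (g n))).
  - apply (comp_prec O f (fun _ _ r => Nat.pred r)); auto.
    apply (comp_pred O snd'), (comp_snd O (fun n => n)), comp_id.
  - intros n; induction (g n) as [|k IH]; simpl; [lia | rewrite IH; lia].
Qed.

Lemma comp_add O f g : Comp O f -> Comp O g -> Comp O (fun n => f n + g n).
Proof.
  intros Hf Hg.
  apply (comp_ext _ (fun n => prec (f n) (fun _ r => S r) (g n))).
  - apply (comp_prec O f (fun _ _ r => S r)); auto.
    apply (comp_succ O snd'), (comp_snd O (fun n => n)), comp_id.
  - intros n; induction (g n) as [|k IH]; simpl; [lia | rewrite IH; lia].
Qed.

Lemma comp_mul O f g : Comp O f -> Comp O g -> Comp O (fun n => f n * g n).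
Proof.
  intros Hf Hg.
  apply (comp_ext _ (fun n => prec 0 (fun _ r => f n + r) (g n))).
  - apply (comp_prec O (fun _ => 0) (fun n _ r => f n + r)); auto using comp_const.
    apply (comp_add O (fun z => f (fst' (fst' z))) snd').
    + apply (comp_app O f (fun z => fst' (fst' z))); auto.
      apply (comp_fst O fst'), (comp_fst O (fun n => n)), comp_id.
    + apply (comp_snd O (fun n => n)), comp_id.
  - intros n; induction (g n) as [|k IH]; simpl; [lia | rewrite IH; lia].
Qed.

Lemma compB_nz O f : Comp O f -> CompB O (fun n => negb (f n =? 0)).
Proof.
  intros Hf; apply (comp_ext _ (fun n => 1 - (1 - f n))).
  - apply comp_sub; [apply comp_const|]; apply comp_sub; [apply comp_const|]; auto.
  - intros n; destruct (f n); simpl; lia.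
Qed.

Lemma compB_negb O b : CompB O b -> CompB O (fun n => negb (b n)).
Proof.
  intros Hf; apply (comp_ext _ (fun n => 1 - Nat.b2n (b n))).
  - apply comp_sub; [apply comp_const|]; auto.
  - intros n; destruct (b n); reflexivity.
Qed.

Lemma comp_if O b f g :
  CompB O b -> Comp O f -> Comp O g -> Comp O (fun n => if b n then f n else g n).
Proof.
  intros Hb Hf Hg.
  apply (comp_ext _ (fun n => Nat.b2n (b n) * f n + Nat.b2n (negb (b n)) * g n)).
  - apply comp_add; apply comp_mul; auto; now apply compB_negb.
  - intros n; destruct (b n); simpl; lia.
Qed.

Lemma compB_if O b f g :
  CompB O b -> CompB O f -> CompB O g -> CompB O (fun n => if b n then f n else g n).
Proof.
  intros Hb Hf Hg; apply (comp_ext _ _ _ (comp_if O _ _ _ Hb Hf Hg)).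
  intros n; destruct (b n); reflexivity.
Qed.

Lemma compB_ext O f g : CompB O f -> (forall n, f n = g n) -> CompB O g.
Proof. intros H E; apply (comp_ext _ _ _ H); intros n; now rewrite E. Qed.

Lemma compB_const O b : CompB O (fun _ => b).
Proof. exact (comp_const O (Nat.b2n b)). Qed.

Lemma compB_and O f g : CompB O f -> CompB O g -> CompB O (fun n => f n && g n).
Proof. intros Hf Hg; apply compB_if; auto using compB_const. Qed.

Lemma compB_or O f g : CompB O f -> CompB O g -> CompB O (fun n => f n || g n).
Proof. intros Hf Hg; apply compB_if; auto using compB_const. Qed.

Lemma compB_leb O f g : Comp O f -> Comp O g -> CompB O (fun n => f n <=? g n).
Proof.
  intros Hf Hg; apply (compB_ext _ (fun n => negb (negb (f n - g n =? 0)))).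
  - apply (compB_negb O (fun n => negb (f n - g n =? 0))), (compB_nz O (fun n => f n - g n)), comp_sub; auto.
  - intros n; rewrite negb_involutive; apply eq_true_iff_eq.
    rewrite Nat.eqb_eq, Nat.leb_le; lia.
Qed.

Lemma compB_ltb O f g : Comp O f -> Comp O g -> CompB O (fun n => f n <? g n).
Proof. intros Hf Hg; apply compB_leb; auto using comp_succ. Qed.

Lemma compB_eqb O f g : Comp O f -> Comp O g -> CompB O (fun n => f n =? g n).
Proof.
  intros Hf Hg; apply (compB_ext _ (fun n => (f n <=? g n) && (g n <=? f n))).
  - apply compB_and; apply compB_leb; auto.
  - intros n; apply eq_true_iff_eq.
    rewrite andb_true_iff, Nat.eqb_eq, !Nat.leb_le; lia.
Qed.

Lemma compB_app O b g : CompB O b -> Comp O g -> CompB O (fun n => b (g n)).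
Proof. intros H1 H2; exact (comp_app O (fun x => Nat.b2n (b x)) _ H1 H2). Qed.

Lemma compB_app2 O F f g :
  CompB2 O F -> Comp O f -> Comp O g -> CompB O (fun n => F (f n) (g n)).
Proof. intros H1 H2 H3; exact (comp_app2 O (fun x y => Nat.b2n (F x y)) _ _ H1 H2 H3). Qed.

Lemma compB_app3 O F f g h :
  CompB3 O F -> Comp O f -> Comp O g -> Comp O h ->
  CompB O (fun n => F (f n) (g n) (h n)).
Proof. intros H1 H2 H3 H4; exact (comp_app3 O (fun x y z => Nat.b2n (F x y z)) _ _ _ H1 H2 H3 H4). Qed.

Fixpoint ball (n : nat) (b : nat -> bool) : bool :=
  match n with 0 => true | S k => b k && ball k b end.
Definition bex (n : nat) (b : nat -> bool) : bool := negb (ball n (fun k => negb (b k))).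

Lemma ball_spec n b : ball n b = true <-> forall k, k < n -> b k = true.
Proof.
  induction n as [|n IH]; simpl.
  - split; [intros _ k Hk; lia | auto].
  - rewrite andb_true_iff, IH; split.
    + intros [H1 H2] k Hk; destruct (Nat.eq_dec k n) as [->|]; auto.
      apply H2; lia.
    + intros H; split; [apply H; lia | intros k Hk; apply H; lia].
Qed.

Lemma bex_spec n b : bex n b = true <-> exists k, k < n /\ b k = true.
Proof.
  unfold bex; rewrite negb_true_iff, <- not_true_iff_false, ball_spec; split.
  - intros H; apply NNPP; intros H'; apply H; intros k Hk.
    rewrite negb_true_iff, <- not_true_iff_false; intros E; eauto.
  - intros (k & Hk & E) H; specialize (H k Hk); rewrite E in H; discriminate.
Qed.

Lemma compB_ball O f b :
  Comp O f -> CompB2 O b -> CompB O (fun n => ball (f n) (b n)).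
Proof.
  intros Hf Hb.
  apply (comp_ext _ (fun n => prec 1 (fun k r => Nat.b2n (b n k) * r) (f n))).
  - apply (comp_prec O (fun _ => 1) (fun n k r => Nat.b2n (b n k) * r));
      auto using comp_const.
    apply comp_mul.
    + apply (comp_app O (fun z => Nat.b2n (b (fst' z) (snd' z))) fst'); auto.
      apply (comp_fst O (fun n => n)), comp_id.
    + apply (comp_snd O (fun n => n)), comp_id.
  - intros n; induction (f n) as [|k IH]; simpl; auto.
    rewrite IH; destruct (b n k); simpl; lia.
Qed.

Lemma compB_bex O f b :
  Comp O f -> CompB2 O b -> CompB O (fun n => bex (f n) (b n)).
Proof.
  intros Hf Hb; apply compB_negb.
  apply (compB_ball O f (fun n k => negb (b n k))); auto.
  now apply (compB_negb O (fun z => b (fst' z) (snd' z))).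
Qed.

Lemma comp_min O b g :
  CompB2 O b -> (forall n, b n (g n) = true /\ forall y, y < g n -> b n y = false) ->
  Comp O g.
Proof.
  intros Hb Hg.
  destruct (compB_negb O (fun z => b (fst' z) (snd' z)) Hb) as [p Hp].
  exists (CMu p); intros n; destruct (Hg n) as [H1 H2]; constructor.
  - specialize (Hp (pair n (g n))).
    now rewrite fst_pair, snd_pair, H1 in Hp.
  - intros y Hy; exists 1; split; auto.
    specialize (Hp (pair n y)); now rewrite fst_pair, snd_pair, (H2 y Hy) in Hp.
Qed.

Lemma least_true (b : nat -> bool) n :
  b n = true -> exists m, m <= n /\ b m = true /\ forall y, y < m -> b y = false.
Proof.
  revert b; induction n as [|n IH]; intros b H; [exists 0; repeat split; auto; lia|].
  destruct (b 0) eqn:E; [exists 0; repeat split; auto; lia|].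
  destruct (IH (fun k => b (S k)) H) as (m & H1 & H2 & H3).
  exists (S m); repeat split; auto; [lia|].
  intros [|y] Hy; auto; apply H3; lia.
Qed.

(** The least witness is unique, so the function picked by description is the one that [CMu]
    computes. *)
Lemma comp_search O b :
  CompB2 O b -> (forall n, exists y, b n y = true) ->
  exists g, Comp O g /\
    forall n, b n (g n) = true /\ forall y, y < g n -> b n y = false.
Proof.
  intros Hb H.
  assert (H' : forall n, exists y, b n y = true /\ forall z, z < y -> b n z = false).
  { intros n; destruct (H n) as [y Hy].
    destruct (least_true _ _ Hy) as (m & _ & Hm); eauto. }
  set (g n := proj1_sig (constructive_indefinite_description _ (H' n))).
  assert (Hg : forall n, b n (g n) = true /\ forall z, z < g n -> b n z = false)
    by (intros n; exact (proj2_sig (constructive_indefinite_description _ (H' n)))).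
  exists g; split; [now apply (comp_min O b) | exact Hg].
Qed.

(* Extension slots, filled in when the corresponding closure lemmas are available. *)
Ltac comp_arith := fail.
Ltac comp_machine := fail.
Ltac comp_struct := fail.
Ltac comp_step :=
  match goal with
  | |- Comp2 _ _ => unfold Comp2; cbv beta
  | |- Comp3 _ _ => unfold Comp3; cbv beta
  | |- CompB2 ?O ?b =>
      change (CompB O (fun z => b (fst' z) (snd' z))); cbv beta
  | |- CompB3 ?O ?b =>
      change (CompB O (fun z => b (fst' (fst' z)) (snd' (fst' z)) (snd' z))); cbv beta
  | |- Comp _ _ => assumption
  | |- CompB _ _ => assumption
  | |- Comp _ (fun n => n) => apply comp_id
  | |- Comp _ (fun _ => ?k) => apply (comp_const _ k)
  | |- CompB _ (fun _ => ?k) => apply (compB_const _ k)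
  | |- Comp ?O (fun n => Nat.b2n (@?b n)) => change (CompB O b)
  | |- Comp _ (fun n => S (@?f n)) => apply (comp_succ _ f)
  | |- Comp _ (fun n => Nat.pred (@?f n)) => apply (comp_pred _ f)
  | |- Comp _ (fun n => fst' (@?f n)) => apply (comp_fst _ f)
  | |- Comp _ (fun n => snd' (@?f n)) => apply (comp_snd _ f)
  | |- Comp _ (fun n => pair (@?f n) (@?g n)) => apply (comp_pair _ f g)
  | |- Comp _ (fun n => @?f n + @?g n) => apply (comp_add _ f g)
  | |- Comp _ (fun n => @?f n - @?g n) => apply (comp_sub _ f g)
  | |- Comp _ (fun n => @?f n * @?g n) => apply (comp_mul _ f g)
  | |- Comp _ (fun n => if @?b n then @?f n else @?g n) => apply (comp_if _ b f g)
  | |- Comp _ (fun n => prec (@?a n) (@?g n) (@?h n)) => apply (comp_prec _ a g h)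
  | |- CompB _ (fun n => if @?b n then @?f n else @?g n) => apply (compB_if _ b f g)
  | |- CompB _ (fun n => negb (@?f n)) => apply (compB_negb _ f)
  | |- CompB _ (fun n => @?f n && @?g n) => apply (compB_and _ f g)
  | |- CompB _ (fun n => @?f n || @?g n) => apply (compB_or _ f g)
  | |- CompB _ (fun n => @?f n <=? @?g n) => apply (compB_leb _ f g)
  | |- CompB _ (fun n => @?f n <? @?g n) => apply (compB_ltb _ f g)
  | |- CompB _ (fun n => @?f n =? @?g n) => apply (compB_eqb _ f g)
  | |- CompB _ (fun n => ball (@?f n) (@?b n)) => apply (compB_ball _ f b)
  | |- CompB _ (fun n => bex (@?f n) (@?b n)) => apply (compB_bex _ f b)
  | H : Comp3 ?O ?F |- Comp ?O (fun n => ?F (@?f n) (@?g n) (@?h n)) =>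
      apply (comp_app3 O F f g h H)
  | H : Comp2 ?O ?F |- Comp ?O (fun n => ?F (@?f n) (@?g n)) =>
      apply (comp_app2 O F f g H)
  | H : Comp ?O ?F |- Comp ?O (fun n => ?F (@?f n)) => apply (comp_app O F f H)
  | H : CompB3 ?O ?F |- CompB ?O (fun n => ?F (@?f n) (@?g n) (@?h n)) =>
      apply (compB_app3 O F f g h H)
  | H : CompB2 ?O ?F |- CompB ?O (fun n => ?F (@?f n) (@?g n)) =>
      apply (compB_app2 O F f g H)
  | H : CompB ?O ?F |- CompB ?O (fun n => ?F (@?f n)) => apply (compB_app O F f H)
  | _ => first [comp_arith | comp_machine | comp_struct]
  end.
Ltac comp := repeat comp_step.

Lemma comp_div O d f : 0 < d -> Comp O f -> Comp O (fun n => f n / d).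
Proof.
  intros Hd Hf.
  apply (comp_min O (fun n y => f n <? d * S y)); [comp|].
  intros n; assert (E := Nat.div_mod (f n) d ltac:(lia)).
  assert (B := Nat.mod_upper_bound (f n) d ltac:(lia)).
  split; [apply Nat.ltb_lt; nia|].
  intros y Hy; apply Nat.ltb_ge; nia.
Qed.

Lemma comp_mod O d f : 0 < d -> Comp O f -> Comp O (fun n => f n mod d).
Proof.
  intros Hd Hf; apply (comp_ext _ (fun n => f n - d * (f n / d))).
  - comp; now apply comp_div.
  - intros n; rewrite (Nat.Div0.mod_eq (f n) d); lia.
Qed.

Ltac comp_arith ::=
  match goal with
  | |- Comp _ (fun n => @?f n / ?d) => apply (comp_div _ d f (Nat.lt_0_succ _))
  | |- Comp _ (fun n => @?f n mod ?d) => apply (comp_mod _ d f (Nat.lt_0_succ _))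
  end.

(** The empty oracle answers every query with 0, so [CZero] can stand in for [COracle] and the
    program then runs under any oracle. *)
Fixpoint strip (c : code) : code :=
  match c with
  | COracle => CZero
  | CComp f g => CComp (strip f) (strip g)
  | CPair f g => CPair (strip f) (strip g)
  | CRec f g => CRec (strip f) (strip g)
  | CMu f => CMu (strip f)
  | c => c
  end.

Lemma eval_strip O c x y : eval empty_oracle c x y -> eval O (strip c) x y.
Proof.
  intros H; induction H using eval_strong_ind; simpl;
    try (econstructor; eauto; fail).
  - contradiction.
  - constructor; auto.
    intros z Hz; destruct (H0 z Hz) as (v & H1 & _ & H2); eauto.
Qed.

Lemma comp_lift O f : Comp empty_oracle f -> Comp O f.
Proof. intros [p Hp]; exists (strip p); auto using eval_strip. Qed.

Lemma decidable_of_compB O b (A : nat -> Prop) :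
  CompB O b -> (forall n, b n = true <-> A n) -> O_decidable O A.
Proof.
  intros [p Hp] E; exists p; intros n; specialize (Hp n); specialize (E n).
  destruct (b n); [left | right]; split; auto.
  - now apply E.
  - now intros H; apply E in H.
Qed.

Lemma compB_of_decidable O A :
  O_decidable O A -> exists b, CompB O b /\ forall n, b n = true <-> A n.
Proof.
  intros [p Hp].
  exists (fun n => if excluded_middle_informative (A n) then true else false).
  split.
  - exists p; intros n; destruct (excluded_middle_informative (A n));
      destruct (Hp n) as [[]|[]]; tauto || auto.
  - intros n; destruct (excluded_middle_informative (A n)); split; auto; discriminate.
Qed.

(** * Gödel numbers and a universal stack machine *)

Lemma div10_lt n : n <> 0 -> n / 10 < n.
Proof. intros H; apply Nat.div_lt; lia. Qed.

(** Components of a nonzero [n] are at most [n / 10], hence smaller than [n], so fuel [n] never runs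
    out. *)
Lemma decode_aux_fuel fuel n : n <= fuel -> decode_aux fuel n = decode_aux n n.
Proof.
  revert n; induction fuel as [fuel IH] using lt_wf_ind; intros n Hn.
  destruct (Nat.eq_dec n 0) as [->|Hz]; [destruct fuel; reflexivity|].
  destruct fuel as [|fuel]; [lia|]; destruct n as [|n]; [lia|].
  assert (Hk := div10_lt (S n) ltac:(lia)).
  assert (Ha := fst_le (S n / 10)); assert (Hb := snd_le (S n / 10)).
  cbn [decode_aux].
  rewrite !(IH fuel (Nat.lt_succ_diag_r _)) by lia.
  now rewrite !(IH n) by lia.
Qed.

Lemma decode_eq n :
  decode n =
  let k := n / 10 in
  match n mod 10 with
  | 0 => CZero
  | 1 => CSucc
  | 2 => CId
  | 3 => CFst
  | 4 => CSnd
  | 5 => COracle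
  | 6 => CComp (decode (fst' k)) (decode (snd' k))
  | 7 => CPair (decode (fst' k)) (decode (snd' k))
  | 8 => CRec (decode (fst' k)) (decode (snd' k))
  | _ => CMu (decode k)
  end.
Proof.
  destruct n as [|n]; [reflexivity|].
  assert (Hk := div10_lt (S n) ltac:(lia)).
  assert (Ha := fst_le (S n / 10)); assert (Hb := snd_le (S n / 10)).
  unfold decode at 1; cbn [decode_aux].
  now rewrite !(decode_aux_fuel n) by lia.
Qed.

Fixpoint encode (c : code) : nat :=
  match c with
  | CZero => 0
  | CSucc => 1
  | CId => 2
  | CFst => 3
  | CSnd => 4
  | COracle => 5
  | CComp f g => 10 * pair (encode f) (encode g) + 6
  | CPair f g => 10 * pair (encode f) (encode g) + 7
  | CRec f g => 10 * pair (encode f) (encode g) + 8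
  | CMu f => 10 * encode f + 9
  end.

Lemma div10_add k r : r < 10 -> (10 * k + r) / 10 = k.
Proof. intros H; symmetry; now apply (Nat.div_unique _ 10 k r). Qed.

Lemma mod10_add k r : r < 10 -> (10 * k + r) mod 10 = r.
Proof. intros H; symmetry; now apply (Nat.mod_unique _ 10 k r). Qed.

Lemma decode_encode c : decode (encode c) = c.
Proof.
  induction c; try reflexivity; cbn [encode]; rewrite decode_eq; cbv zeta;
    rewrite div10_add, mod10_add by lia; rewrite ?fst_pair, ?snd_pair; congruence.
Qed.

(* Configurations of the machine: evaluate code [e] on [x] with continuation
   stack [K], or return [v] to [K]; a frame consists of a tag and data. *)
Definition Ev (e x K : nat) : nat := pair 0 (pair e (pair x K)).
Definition Rt (v K : nat) : nat := pair 1 (pair v K).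
Definition push (t d K : nat) : nat := S (pair (pair t d) K).

Definition step_ev (q : nat -> bool) (e x K : nat) : nat :=
  if e mod 10 =? 0 then Rt 0 K else
  if e mod 10 =? 1 then Rt (S x) K else
  if e mod 10 =? 2 then Rt x K else
  if e mod 10 =? 3 then Rt (fst' x) K else
  if e mod 10 =? 4 then Rt (snd' x) K else
  if e mod 10 =? 5 then Rt (Nat.b2n (q x)) K else
  if e mod 10 =? 6 then Ev (snd' (e / 10)) x (push 0 (fst' (e / 10)) K) else
  if e mod 10 =? 7 then Ev (fst' (e / 10)) x (push 1 (pair (snd' (e / 10)) x) K) else
  if e mod 10 =? 8 then
    if snd' x =? 0 then Ev (fst' (e / 10)) (fst' x) K
    else Ev e (pair (fst' x) (Nat.pred (snd' x)))
      (push 3 (pair (snd' (e / 10)) (pair (fst' x) (Nat.pred (snd' x)))) K)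
  else Ev (e / 10) (pair x 0) (push 4 (pair (e / 10) (pair x 0)) K).

(** Frame tags: 0 applies the outer function of a composition, 1 and 2 wait for the first and second
    component of a pair, 3 applies the recursion step, 4 tests one candidate of a minimisation. *)
Definition step_frame (v t d K : nat) : nat :=
  if t =? 0 then Ev d v K else
  if t =? 1 then Ev (fst' d) (snd' d) (push 2 v K) else
  if t =? 2 then Rt (pair d v) K else
  if t =? 3 then Ev (fst' d) (pair (snd' d) v) K else
  if v =? 0 then Rt (snd' (snd' d)) K
  else Ev (fst' d) (pair (fst' (snd' d)) (S (snd' (snd' d))))
         (push 4 (pair (fst' d) (pair (fst' (snd' d)) (S (snd' (snd' d))))) K).

Definition step_rt (v K : nat) : nat :=
  if K =? 0 then Rt v K
  else step_frame v (fst' (fst' (Nat.pred K))) (snd' (fst' (Nat.pred K)))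
         (snd' (Nat.pred K)).

Definition step (q : nat -> bool) (c : nat) : nat :=
  if fst' c =? 0
  then step_ev q (fst' (snd' c)) (fst' (snd' (snd' c))) (snd' (snd' (snd' c)))
  else step_rt (fst' (snd' c)) (snd' (snd' c)).

Definition runs (q : nat -> bool) (c n : nat) : nat := prec c (fun _ c => step q c) n.

(** The value 0 means still running; a final value [v] is reported as [S v]. *)
Definition result (c : nat) : nat :=
  if fst' c =? 0 then 0 else
  if snd' (snd' c) =? 0 then S (fst' (snd' c)) else 0.

Lemma step_Ev q e x K : step q (Ev e x K) = step_ev q e x K.
Proof. unfold step, Ev; now rewrite !snd_pair, !fst_pair, ?snd_pair. Qed.

Lemma step_Rt q v K : step q (Rt v K) = step_rt v K.
Proof. unfold step, Rt; now rewrite !snd_pair, !fst_pair, ?snd_pair. Qed.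

Lemma step_push q v t d K : step q (Rt v (push t d K)) = step_frame v t d K.
Proof.
  rewrite step_Rt; unfold step_rt, push; cbn [Nat.eqb Nat.pred].
  now rewrite !snd_pair, !fst_pair, ?snd_pair.
Qed.

Lemma runs_S q c n : runs q c (S n) = runs q (step q c) n.
Proof. induction n as [|n IH]; [reflexivity|]; cbn in *; now rewrite IH. Qed.

Lemma runs_add q c m n : runs q c (m + n) = runs q (runs q c m) n.
Proof.
  revert c; induction m as [|m IH]; intros c; [reflexivity|].
  cbn [Nat.add]; now rewrite !runs_S, IH.
Qed.

Lemma runs_final q v n : runs q (Rt v 0) n = Rt v 0.
Proof.
  induction n as [|n IH]; [reflexivity|].
  now rewrite runs_S, step_Rt.
Qed.

Lemma result_final v : result (Rt v 0) = S v.
Proof. unfold result, Rt; now rewrite !fst_pair, !snd_pair, fst_pair. Qed.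

(* A single bound [n] on the number of steps serves for all late enough
   approximations to the oracle, which makes the machine a limit approximation. *)
Definition reaches (q : nat -> nat -> bool) (c v : nat -> nat) : Prop :=
  exists n t, forall s, t <= s -> forall K, runs (q s) (c K) n = v K.

Lemma reaches_trans q a b c : reaches q a b -> reaches q b c -> reaches q a c.
Proof.
  intros (n & t & H) (n' & t' & H'); exists (n + n'), (max t t'); intros s Hs K.
  rewrite runs_add, H, H'; auto; lia.
Qed.

Lemma reaches_step q a b : (forall s K, step (q s) (a K) = b K) -> reaches q a b.
Proof. intros H; exists 1, 0; intros s _ K; cbn; apply H. Qed.

Lemma reaches_stack q a b g :
  reaches q a b -> reaches q (fun K => a (g K)) (fun K => b (g K)).
Proof. intros (n & t & H); exists n, t; auto. Qed.

Lemma decode_inv e c :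
  decode e = c ->
  match c with
  | CZero => e mod 10 = 0
  | CSucc => e mod 10 = 1
  | CId => e mod 10 = 2
  | CFst => e mod 10 = 3
  | CSnd => e mod 10 = 4
  | COracle => e mod 10 = 5
  | CComp f g => e mod 10 = 6 /\ decode (fst' (e / 10)) = f /\ decode (snd' (e / 10)) = g
  | CPair f g => e mod 10 = 7 /\ decode (fst' (e / 10)) = f /\ decode (snd' (e / 10)) = g
  | CRec f g => e mod 10 = 8 /\ decode (fst' (e / 10)) = f /\ decode (snd' (e / 10)) = g
  | CMu f => e mod 10 = 9 /\ decode (e / 10) = f
  end.
Proof.
  intros <-; rewrite decode_eq; cbv zeta.
  assert (B := Nat.mod_upper_bound e 10 ltac:(lia)).
  destruct (e mod 10) as [|[|[|[|[|[|[|[|[|r]]]]]]]]]; auto.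
  split; auto; lia.
Qed.

(** A derivation asks only finitely many oracle questions, so all of them are answered correctly
    from some stage on. *)
Lemma machine_complete (O : oracle) (q : nat -> nat -> bool) :
  (forall x, exists t, forall s, t <= s -> (q s x = true <-> O x)) ->
  forall c x y, eval O c x y ->
  forall e, decode e = c -> reaches q (Ev e x) (Rt y).
Proof.
  intros Hq c x y H; induction H using eval_strong_ind; intros e He;
    apply decode_inv in He.
  1-5: apply reaches_step; intros s K; rewrite step_Ev; unfold step_ev;
    rewrite He; reflexivity.
  - destruct (Hq x) as [t Ht]; exists 1, t; intros s Hs K; cbn -[step].
    rewrite step_Ev; unfold step_ev; rewrite He; cbn.
    now rewrite (proj2 (Ht s Hs) H).
  - destruct (Hq x) as [t Ht]; exists 1, t; intros s Hs K; cbn -[step].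
    rewrite step_Ev; unfold step_ev; rewrite He; cbn.
    destruct (q s x) eqn:E; auto; apply Ht in E; tauto.
  - destruct He as (E & E1 & E2).
    eapply reaches_trans;
      [|eapply reaches_trans; [apply (reaches_stack _ _ _ (push 0 (fst' (e / 10))) (IHeval1 _ E2))|]].
    + apply reaches_step; intros s K; rewrite step_Ev; unfold step_ev; rewrite E; reflexivity.
    + eapply reaches_trans; [|apply (IHeval2 _ E1)].
      apply reaches_step; intros s K; now rewrite step_push.
  - destruct He as (E & E1 & E2).
    eapply reaches_trans;
      [|eapply reaches_trans; [apply (reaches_stack _ _ _ (push 1 (pair (snd' (e / 10)) x)) (IHeval1 _ E1))|]].
    + apply reaches_step; intros s K; rewrite step_Ev; unfold step_ev; rewrite E; reflexivity.
    + eapply reaches_trans;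
        [|eapply reaches_trans; [apply (reaches_stack _ _ _ (push 2 y) (IHeval2 _ E2))|]].
      * apply reaches_step; intros s K; rewrite step_push; unfold step_frame; cbn [Nat.eqb].
        now rewrite fst_pair, snd_pair.
      * apply reaches_step; intros s K; now rewrite step_push.
  - destruct He as (E & E1 & E2).
    eapply reaches_trans; [|apply (IHeval _ E1)].
    apply reaches_step; intros s K; rewrite step_Ev; unfold step_ev; rewrite E; cbn [Nat.eqb].
    now rewrite snd_pair, fst_pair.
  - destruct He as (E & E1 & E2).
    eapply reaches_trans;
      [|eapply reaches_trans; [eapply (reaches_stack _ _ _ (push 3 (pair (snd' (e / 10)) (pair x n))))|]].
    2: apply (IHeval1 e); rewrite decode_eq, E; cbv zeta; congruence.
    + apply reaches_step; intros s K; rewrite step_Ev; unfold step_ev; rewrite E; cbn [Nat.eqb].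
      now rewrite snd_pair, fst_pair.
    + eapply reaches_trans; [|apply (IHeval2 _ E2)].
      apply reaches_step; intros s K; rewrite step_push; unfold step_frame; cbn [Nat.eqb].
      now rewrite fst_pair, snd_pair.
  - destruct He as (E & E1); set (k := e / 10) in *.
    (* Here [j] is the distance from the candidate under test to the least zero [y]. *)
    assert (loop : forall j, j <= y ->
      reaches q (fun K => Ev k (pair x (y - j)) (push 4 (pair k (pair x (y - j))) K)) (Rt y)).
    { induction j as [|j IHj]; intros Hj.
      - rewrite Nat.sub_0_r.
        eapply reaches_trans; [apply (reaches_stack _ _ _ (push 4 (pair k (pair x y))) (IHeval _ E1))|].
        apply reaches_step; intros s K; rewrite step_push; unfold step_frame; cbn [Nat.eqb].
        now rewrite !snd_pair.
      - destruct (H0 (y - S j) ltac:(lia)) as (v & Hv & _ & IHv).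
        eapply reaches_trans;
          [apply (reaches_stack _ _ _ (push 4 (pair k (pair x (y - S j)))) (IHv _ E1))|].
        eapply reaches_trans; [|apply IHj; lia].
        apply reaches_step; intros s K; rewrite step_push; unfold step_frame; cbn [Nat.eqb].
        rewrite !fst_pair, !snd_pair, !fst_pair.
        replace (y - j) with (S (y - S j)) by lia.
        destruct v; [lia | reflexivity]. }
    eapply reaches_trans; [|apply (loop y (Nat.le_refl _))]; rewrite Nat.sub_diag.
    apply reaches_step; intros s K; rewrite step_Ev; unfold step_ev; rewrite E; reflexivity.
Qed.

(** * Step-bounded runs and the normal form of partial computable functions *)

Definition approx (q : nat -> bool) (e x s : nat) : nat := result (runs q (Ev e x 0) s).

Lemma approx_limit (O : oracle) (q : nat -> nat -> bool) e x y :
  (forall x, exists t, forall s, t <= s -> (q s x = true <-> O x)) ->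
  eval O (decode e) x y ->
  exists t, forall s, t <= s -> approx (q s) e x s = S y.
Proof.
  intros Hq H.
  destruct (machine_complete O q Hq _ _ _ H e eq_refl) as (n & t & Hn).
  exists (max n t); intros s Hs; unfold approx.
  replace s with (n + (s - n)) at 2 by lia.
  rewrite runs_add, Hn, runs_final by lia; apply result_final.
Qed.

Section Soundness.
Let q (x : nat) : bool := false.

(** A frame that receives [v] passes [y] to the rest of the stack. For a minimisation frame, [v] is
    the value at the candidate [k], and [y] is the least zero from [k] on. *)
Definition frame_sem (t d v y : nat) : Prop :=
  match t with
  | 0 => phi d v y
  | 1 => exists u, phi (fst' d) (snd' d) u /\ y = pair v u
  | 2 => y = pair d v
  | 3 => phi (fst' d) (pair (snd' d) v) y
  | _ => let x := fst' (snd' d) in let k := snd' (snd' d) in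
      (v = 0 /\ y = k) \/
      (v <> 0 /\ k < y /\ phi (fst' d) (pair x y) 0 /\
       forall z, k < z < y -> exists v, v <> 0 /\ phi (fst' d) (pair x z) v)
  end.

Inductive stack_sem : nat -> nat -> nat -> Prop :=
| ss_nil v : stack_sem 0 v v
| ss_cons t d K v y z :
    frame_sem t d v y -> stack_sem K y z -> stack_sem (push t d K) v z.

(** The final value that a configuration denotes. Soundness travels backwards along a run: if the
    successor denotes [z], so does the configuration itself. *)
Definition conf_sem (c z : nat) : Prop :=
  if fst' c =? 0
  then exists v, phi (fst' (snd' c)) (fst' (snd' (snd' c))) v /\
         stack_sem (snd' (snd' (snd' c))) v z
  else stack_sem (snd' (snd' c)) (fst' (snd' c)) z.

Lemma conf_sem_Ev e x K z :
  conf_sem (Ev e x K) z <-> exists v, phi e x v /\ stack_sem K v z.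
Proof. unfold conf_sem, Ev; now rewrite !snd_pair, !fst_pair, ?snd_pair. Qed.

Lemma conf_sem_Rt v K z : conf_sem (Rt v K) z <-> stack_sem K v z.
Proof. unfold conf_sem, Rt; now rewrite !snd_pair, !fst_pair, ?snd_pair. Qed.

Lemma stack_sem_push t d K v z :
  stack_sem (push t d K) v z <-> exists y, frame_sem t d v y /\ stack_sem K y z.
Proof.
  split; [|intros (y & H1 & H2); econstructor; eauto].
  remember (push t d K) as k eqn:E; intros H; destruct H as [w|t' d' K' w y w' H1 H2];
    [discriminate|].
  injection E as E; apply pair_inj in E as [E <-]; apply pair_inj in E as [<- <-]; eauto.
Qed.

Lemma step_ev_sound e x K z :
  conf_sem (step_ev q e x K) z -> conf_sem (Ev e x K) z.
Proof.
  rewrite (conf_sem_Ev e); unfold step_ev.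
  assert (D := decode_eq e); cbv zeta in D.
  assert (B := Nat.mod_upper_bound e 10 ltac:(lia)).
  destruct (e mod 10) as [|[|[|[|[|[|[|[|[|r]]]]]]]]] eqn:E; cbn [Nat.eqb].
  1-6: rewrite conf_sem_Rt; intros H; eexists; split; [|exact H]; unfold phi, Phi;
    rewrite D; try (constructor; fail); simpl; apply ev_or0; intros [].
  - rewrite conf_sem_Ev; intros (v & Hv & H).
    apply stack_sem_push in H as (y & Hy & H); exists y; split; auto.
    unfold phi, Phi; rewrite D; econstructor; eauto.
  - rewrite conf_sem_Ev; intros (v & Hv & H).
    apply stack_sem_push in H as (y & (u & Hy & ->) & H); exists (pair v u); split; auto.
    rewrite fst_pair, snd_pair in Hy.
    unfold phi, Phi; rewrite D; econstructor; eauto.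
  - rewrite <- (pair_eta x); rewrite fst_pair, snd_pair.
    destruct (snd' x) as [|n]; cbn [Nat.eqb Nat.pred]; rewrite conf_sem_Ev; intros (v & Hv & H).
    + exists v; split; auto; unfold phi, Phi; rewrite D; constructor; auto.
    + apply stack_sem_push in H as (y & Hy & H); exists y; split; auto.
      cbn in Hy; rewrite fst_pair, snd_pair in Hy.
      unfold phi, Phi in *; rewrite D in *; econstructor; eauto.
  - replace r with 0 in * by lia.
    rewrite conf_sem_Ev; intros (v & Hv & H).
    apply stack_sem_push in H as (y & Hy & H); exists y; split; auto.
    cbn in Hy; rewrite !fst_pair, !snd_pair, fst_pair in Hy.
    unfold phi, Phi; rewrite D; constructor.
    + destruct Hy as [[-> ->]|(_ & _ & Hy & _)]; auto.
    + intros w Hw; destruct Hy as [[_ ->]|(Hv0 & _ & _ & Hy)]; [lia|].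
      destruct w as [|w]; [eauto | apply Hy; lia].
Qed.

Lemma step_frame_sound v t d K z :
  conf_sem (step_frame v t d K) z -> stack_sem (push t d K) v z.
Proof.
  rewrite stack_sem_push; unfold step_frame.
  destruct t as [|[|[|[|t]]]]; cbn [Nat.eqb].
  - rewrite conf_sem_Ev; auto.
  - rewrite conf_sem_Ev; intros (u & Hu & H); apply stack_sem_push in H as (y & Hy & H).
    cbn in Hy; exists y; split; auto; cbn; eauto.
  - rewrite conf_sem_Rt; cbn; eauto.
  - rewrite conf_sem_Ev; auto.
  - destruct (Nat.eqb_spec v 0) as [->|Hv].
    + rewrite conf_sem_Rt; intros H; eexists; split; [left|]; eauto.
    + rewrite conf_sem_Ev; intros (u & Hu & H); apply stack_sem_push in H as (y & Hy & H).
      exists y; split; auto; right; cbn in Hy.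
      rewrite !fst_pair, !snd_pair, ?fst_pair in Hy.
      destruct Hy as [[-> ->]|(Hu0 & Hlt & Hy & Hz)].
      * split; [|split; [|split]]; auto; intros w Hw; lia.
      * split; [|split; [|split]]; auto; [lia|]; intros w Hw.
        destruct (Nat.eq_dec w (S (snd' (snd' d)))) as [->|]; [eauto | apply Hz; lia].
Qed.

Lemma step_sound c z : conf_sem (step q c) z -> conf_sem c z.
Proof.
  unfold step; destruct (fst' c =? 0) eqn:E.
  - intros H; apply step_ev_sound, conf_sem_Ev in H.
    unfold conf_sem; now rewrite E.
  - unfold step_rt, conf_sem at 2; rewrite E.
    destruct (snd' (snd' c)) as [|K]; cbn [Nat.eqb Nat.pred].
    + now rewrite conf_sem_Rt.
    + intros H; apply step_frame_sound in H.
      unfold push in H; now rewrite !pair_eta in H.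
Qed.
End Soundness.

(** Kleene's predicate and its output function in one: 0 before halting, and the output plus one
    afterwards. *)
Definition T (e x s : nat) : nat := approx (fun _ => false) e x s.

Lemma phi_T e x y : phi e x y <-> exists s, T e x s = S y.
Proof.
  split.
  - intros H; destruct (approx_limit empty_oracle (fun _ _ => false) e x y) as [t Ht]; auto.
    + intros z; exists 0; intros s _; split; [discriminate | intros []].
    + exists t; now apply Ht.
  - intros [s H]; unfold T, approx in H.
    assert (Hs : conf_sem (runs (fun _ => false) (Ev e x 0) s) y).
    { revert H; generalize (runs (fun _ => false) (Ev e x 0) s); intros c.
      unfold result, conf_sem; destruct (fst' c =? 0); [discriminate|].
      destruct (Nat.eqb_spec (snd' (snd' c)) 0) as [->|]; [|discriminate].
      intros E; injection E as ->; constructor. }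
    assert (G : forall s c, conf_sem (runs (fun _ => false) c s) y -> conf_sem c y).
    { clear; induction s as [|s IH]; intros c H; auto.
      rewrite runs_S in H; now apply step_sound, IH. }
    apply G, conf_sem_Ev in Hs; destruct Hs as (v & Hv & Hs).
    now inversion Hs; subst.
Qed.

(** Final configurations are fixed points of [step]. The oracle approximation [q] stays the same
    while the number of steps grows. *)
Lemma approx_mono q e x s s' y :
  approx q e x s = S y -> s <= s' -> approx q e x s' = S y.
Proof.
  intros H Hs; replace s' with (s + (s' - s)) by lia.
  unfold approx in *; rewrite runs_add; revert H.
  generalize (runs q (Ev e x 0) s), (s' - s); clear; intros c n; revert c.
  induction n as [|n IH]; intros c H; auto.
  rewrite runs_S; apply IH.
  unfold result in H; destruct (fst' c =? 0) eqn:E; [discriminate|].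
  destruct (snd' (snd' c) =? 0) eqn:E'; [|discriminate].
  apply Nat.eqb_eq in E'.
  unfold step; rewrite E; unfold step_rt; rewrite E'; cbn [Nat.eqb].
  now rewrite result_final.
Qed.

Lemma T_mono e x s s' y : T e x s = S y -> s <= s' -> T e x s' = S y.
Proof. apply approx_mono. Qed.

Lemma phi_fun e x y y' : phi e x y -> phi e x y' -> y = y'.
Proof.
  rewrite !phi_T; intros [s H] [s' H'].
  apply (T_mono _ _ s (max s s')) in H; [|lia].
  apply (T_mono _ _ s' (max s s')) in H'; [|lia].
  congruence.
Qed.

Lemma eval_fun c x y y' : eval empty_oracle c x y -> eval empty_oracle c x y' -> y = y'.
Proof. rewrite <- (decode_encode c); apply phi_fun. Qed.

(** [step_ev] consults its oracle only at [x], so a single bit [b n] can replace the oracle. *)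
Lemma comp_step_ev O b e x K :
  CompB O b -> Comp O e -> Comp O x -> Comp O K ->
  Comp O (fun n => step_ev (fun _ => b n) (e n) (x n) (K n)).
Proof. intros; unfold step_ev, Ev, Rt, push; comp. Qed.

Lemma comp_step_rt O v K :
  Comp O v -> Comp O K -> Comp O (fun n => step_rt (v n) (K n)).
Proof. intros; unfold step_rt, step_frame, Ev, Rt, push; comp. Qed.

Lemma comp_approx O q w e x s :
  CompB2 O q -> Comp O w -> Comp O e -> Comp O x -> Comp O s ->
  Comp O (fun n => approx (q (w n)) (e n) (x n) (s n)).
Proof.
  intros Hq Hw He Hx Hs; unfold approx, runs.
  assert (Hc : Comp O (fun n => prec (Ev (e n) (x n) 0) (fun _ c => step (q (w n)) c) (s n))).
  { apply (comp_prec O (fun n => Ev (e n) (x n) 0) (fun n _ c => step (q (w n)) c)); auto.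
    - unfold Ev; comp.
    - unfold Comp3, step; apply comp_if; [comp| |].
      + apply (comp_step_ev O (fun z => q (w (fst' (fst' z))) (fst' (snd' (snd' (snd' z))))));
          comp.
      + apply (comp_step_rt O (fun z => fst' (snd' (snd' z)))); comp. }
  apply (comp_app O result _); [unfold result; comp | exact Hc].
Qed.

Lemma comp_T O e x s :
  Comp O e -> Comp O x -> Comp O s -> Comp O (fun n => T (e n) (x n) (s n)).
Proof.
  intros; apply (comp_approx O (fun _ _ => false) (fun _ => 0)); auto; comp.
Qed.

(** * Parametrization and the halting set *)

(** Hand-built codes: 6 and 7 are the tags of [CComp] and [CPair], while 1 and 2 are the codes of
    [CSucc] and [CId]. So [smn p n] feeds [p] with its input paired with the constant [n]. *)
Definition const_index (n : nat) : nat := prec 0 (fun _ r => 10 * pair 1 r + 6) n.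
Definition smn (p : code) (n : nat) : nat :=
  10 * pair (encode p) (10 * pair (const_index n) 2 + 7) + 6.

Lemma comp_smn O p f : Comp O f -> Comp O (fun n => smn p (f n)).
Proof. intros; unfold smn, const_index; comp. Qed.

Lemma decode_comp a b : decode (10 * pair a b + 6) = CComp (decode a) (decode b).
Proof.
  rewrite decode_eq; cbv zeta; rewrite div10_add, mod10_add by lia.
  now rewrite fst_pair, snd_pair.
Qed.

Lemma decode_pair a b : decode (10 * pair a b + 7) = CPair (decode a) (decode b).
Proof.
  rewrite decode_eq; cbv zeta; rewrite div10_add, mod10_add by lia.
  now rewrite fst_pair, snd_pair.
Qed.

Lemma phi_const n x : phi (const_index n) x n.
Proof.
  unfold phi, Phi; induction n as [|n IH]; [constructor|].
  change (const_index (S n)) with (10 * pair 1 (const_index n) + 6).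
  rewrite decode_comp; econstructor; [exact IH | constructor].
Qed.

Lemma phi_smn p n x y : phi (smn p n) x y <-> eval empty_oracle p (pair n x) y.
Proof.
  unfold phi, Phi, smn; rewrite decode_comp, decode_pair, decode_encode; split.
  - intros H; inversion H as [| | | | | | |f g x' u y' Hu Hy| | | |]; subst.
    inversion Hu as [| | | | | | | |f g x' a b Ha Hb| | |]; subst.
    rewrite (eval_fun _ _ _ _ Ha (phi_const n x)) in Hy.
    inversion Hb; subst; exact Hy.
  - intros H; econstructor; [|exact H].
    constructor; [apply phi_const | constructor].
Qed.

(** The program [smn p x] ignores its input and searches for [y], so it halts on its own index
    exactly when a witness exists; one oracle query decides this. *)
Lemma halting_sigma1 b :
  CompB2 empty_oracle b ->
  exists h, CompB halting_set h /\ forall x, h x = true <-> exists y, b x y = true.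
Proof.
  intros Hb.
  assert (Hb' : Comp empty_oracle (fun z => 1 - Nat.b2n (b (fst' (fst' z)) (snd' z)))) by comp.
  destruct Hb' as [c Hc]; set (p := CMu c).
  assert (E : forall x, halting_set (smn p x) <-> exists y, b x y = true).
  { intros x; split.
    - intros [y Hy]; apply phi_smn in Hy.
      inversion Hy as [| | | | | | | | | | |f' x' y' H0 H1]; subst; exists y.
      assert (H2 := eval_fun _ _ _ _ H0 (Hc _)).
      rewrite !fst_pair, !snd_pair in H2; destruct (b x y); auto; discriminate.
    - intros [y Hy]; destruct (least_true _ _ Hy) as (m & _ & Hm & Hlt).
      exists m; apply phi_smn; constructor.
      + specialize (Hc (pair (pair x (smn p x)) m)).
        now rewrite !fst_pair, !snd_pair, Hm in Hc.
      + intros z Hz; exists 1; split; auto; specialize (Hc (pair (pair x (smn p x)) z)).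
        now rewrite !fst_pair, !snd_pair, (Hlt z Hz) in Hc. }
  exists (fun x => if excluded_middle_informative (halting_set (smn p x)) then true else false).
  split.
  - destruct (comp_smn halting_set p _ (comp_id _)) as [r Hr].
    exists (CComp COracle r); intros x; econstructor; [apply Hr|].
    destruct (excluded_middle_informative _); now constructor.
  - intros x; rewrite <- E; destruct (excluded_middle_informative _); split; auto; discriminate.
Qed.

(** * Stage approximations to the halting set *)

Definition HT (s x : nat) : bool := negb (T x x s =? 0).

Lemma HT_mono s s' x : HT s x = true -> s <= s' -> HT s' x = true.
Proof.
  unfold HT; intros H Hs; destruct (T x x s) eqn:E; [discriminate|].
  now rewrite (T_mono _ _ _ _ _ E Hs).
Qed.

Lemma HT_halting x : halting_set x <-> exists s, HT s x = true.
Proof.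
  unfold halting_set, HT; split.
  - intros [y H]; apply phi_T in H as [s H]; exists s; now rewrite H.
  - intros [s H]; destruct (T x x s) eqn:E; [discriminate|].
    exists n; apply phi_T; eauto.
Qed.

Lemma comp_HT O s x : Comp O s -> Comp O x -> CompB O (fun n => HT (s n) (x n)).
Proof.
  intros; assert (Comp O (fun n => T (x n) (x n) (s n))) by (apply comp_T; auto).
  unfold HT; apply compB_nz; auto.
Qed.

Ltac comp_machine ::=
  match goal with
  | |- Comp _ (fun n => T (@?e n) (@?x n) (@?s n)) => apply (comp_T _ e x s)
  | |- CompB _ (fun n => HT (@?s n) (@?x n)) => apply (comp_HT _ s x)
  | |- Comp _ (fun n => approx (HT (@?s n)) (@?e n) (@?x n) (@?k n)) =>
      apply (comp_approx _ HT s e x k)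
  end.

(** One direction of Shoenfield's limit lemma; [s] is both the stage of the oracle and the number of
    steps. *)
Lemma limit_lemma f :
  Comp halting_set f ->
  exists e, forall x, exists t, forall s, t <= s -> approx (HT s) e x s = S (f x).
Proof.
  intros [p Hp]; exists (encode p); intros x.
  apply (approx_limit halting_set HT); [|rewrite decode_encode; auto].
  clear; intros x; destruct (classic (halting_set x)) as [H|H].
  - apply HT_halting in H as [t Ht]; exists t; intros s Hs.
    rewrite (HT_halting x); split; eauto using HT_mono.
  - exists 0; intros s _; rewrite (HT_halting x); split; eauto.
    intros E; destruct H; now apply HT_halting.
Qed.

(** Diagonalisation: on input [x], [CMu c] looks for a zero of a function constantly equal to [b x],
    so on its own code it halts exactly when [b] denies this. *)
Lemma halting_undecidable : ~ decidable_set halting_set.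
Proof.
  intros H; apply compB_of_decidable in H as (b & Hb & E).
  assert (Hc : Comp empty_oracle (fun z => Nat.b2n (b (fst' z)))) by comp.
  destruct Hc as [c Hc]; set (e := encode (CMu c)).
  assert (Hd : halting_set e <-> b e = false).
  { unfold halting_set, phi, Phi, e; rewrite decode_encode; fold e; split.
    - intros [y Hy]; inversion Hy as [| | | | | | | | | | |f' x' y' H0 H1]; subst.
      assert (H2 := eval_fun _ _ _ _ H0 (Hc _)); rewrite fst_pair in H2.
      destruct (b e); auto; discriminate.
    - intros Hf; exists 0; constructor; [|intros; lia].
      specialize (Hc (pair e 0)); now rewrite fst_pair, Hf in Hc. }
  rewrite <- E in Hd; destruct (b e); intuition discriminate.
Qed.

(** * Sizes of classes and embeddings *)

(** Boolean characteristic functions in place of propositions, so that conditions on structures can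
    be handled by [comp]. *)
Record bstr : Type := BStr { bu : nat -> bool; br : nat -> nat -> bool }.

Definition to_es (X : bstr) : eq_struct :=
  EqStruct (fun x => bu X x = true) (fun x y => br X x y = true).

Definition bcomp (O : oracle) (X : bstr) : Prop := CompB O (bu X) /\ CompB2 O (br X).
Definition bequiv (X : bstr) : Prop := is_equivalence_structure (to_es X).

Lemma computable_to_es X :
  bcomp empty_oracle X -> bequiv X -> computable_eq_struct (to_es X).
Proof.
  intros [H1 H2] HX; split; [exact HX|]; split.
  - apply (decidable_of_compB _ (bu X)); auto; intros; reflexivity.
  - apply (decidable_of_compB _ (fun n => br X (fst' n) (snd' n))); auto; intros; reflexivity.
Qed.

Lemma computable_is_to_es M :
  computable_eq_struct M -> exists X, M = to_es X /\ bcomp empty_oracle X /\ bequiv X.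
Proof.
  intros (HM & H1 & H2).
  apply compB_of_decidable in H1 as (b1 & C1 & E1).
  apply compB_of_decidable in H2 as (b2 & C2 & E2).
  exists (BStr b1 (fun x y => b2 (pair x y))).
  assert (E : M = to_es (BStr b1 (fun x y => b2 (pair x y)))).
  { destruct M as [U R]; unfold to_es; cbn in *; f_equal.
    - extensionality x; apply propositional_extensionality; now rewrite E1.
    - extensionality x; extensionality y; apply propositional_extensionality.
      now rewrite E2, fst_pair, snd_pair. }
  split; auto; split; [|unfold bequiv; now rewrite <- E].
  split; [exact C1|]; cbn; comp.
Qed.

(** [br] is unconstrained outside the universe, so membership of both elements is built in. *)
Definition simb (X : bstr) (x y : nat) : bool := bu X x && bu X y && br X x y.
Definition sim (X : bstr) (x y : nat) : Prop := simb X x y = true.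

Lemma sim_iff X x y : sim X x y <-> bu X x = true /\ bu X y = true /\ br X x y = true.
Proof. unfold sim, simb; rewrite !andb_true_iff; tauto. Qed.

Section Sim.
Variables (X : bstr) (HX : bequiv X).

Lemma sim_refl x : bu X x = true -> sim X x x.
Proof. rewrite sim_iff; intros H; repeat split; auto; now apply (proj1 HX). Qed.

Lemma sim_univ_l x y : sim X x y -> bu X x = true.
Proof. intros H; apply sim_iff in H; tauto. Qed.

Lemma sim_sym x y : sim X x y -> sim X y x.
Proof. rewrite !sim_iff; intros (H1 & H2 & H3); repeat split; auto; now apply (proj1 (proj2 HX)). Qed.

Lemma sim_trans x y z : sim X x y -> sim X y z -> sim X x z.
Proof.
  rewrite !sim_iff; intros (H1 & H2 & H3) (_ & H4 & H5); repeat split; auto.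
  now apply (proj2 (proj2 HX)) with y.
Qed.

Lemma simb_congr x x' y : sim X x x' -> simb X x y = simb X x' y.
Proof.
  intros H; apply eq_true_iff_eq; split; intros H'.
  - apply sim_trans with x; auto; now apply sim_sym.
  - now apply sim_trans with x'.
Qed.
End Sim.

Definition cnt (X : bstr) (x s : nat) : nat :=
  prec 0 (fun y c => if simb X x y then S c else c) s.

Definition card_ge (X : bstr) (x n : nat) : Prop := exists s, n <= cnt X x s.

Definition inf (X : bstr) (x : nat) : Prop := forall s, exists y, s <= y /\ sim X x y.

(* Infinitely many classes satisfy [Q]. *)
Definition Many (X : bstr) (Q : nat -> Prop) : Prop :=
  forall n, exists x, bu X x = true /\ Q x /\ forall y, y <= n -> ~ sim X x y.

Lemma cnt_S X x s : cnt X x (S s) = if simb X x s then S (cnt X x s) else cnt X x s.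
Proof. reflexivity. Qed.

Lemma cnt_mono X x s s' : s <= s' -> cnt X x s <= cnt X x s'.
Proof.
  induction 1 as [|s' _ IH]; auto; rewrite cnt_S; destruct (simb X x s'); lia.
Qed.

Lemma cnt_le X x s : cnt X x s <= s.
Proof. induction s as [|s IH]; auto; rewrite cnt_S; destruct (simb X x s); lia. Qed.

Lemma cnt_filter X x s : cnt X x s = length (filter (simb X x) (seq 0 s)).
Proof.
  induction s as [|s IH]; auto.
  rewrite cnt_S, seq_S, filter_app, length_app, <- IH; simpl.
  destruct (simb X x s); simpl; lia.
Qed.

Lemma cnt_congr X x x' s : bequiv X -> sim X x x' -> cnt X x s = cnt X x' s.
Proof.
  intros HX H; induction s as [|s IH]; auto.
  now rewrite !cnt_S, IH, (simb_congr X HX x x').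
Qed.

(** [cnt X x y] is the position of [y] in the class of [x]; the count rises by one at each member,
    so no position is skipped. *)
Lemma cnt_hit X x s j :
  j < cnt X x s -> exists y, sim X x y /\ cnt X x y = j.
Proof.
  induction s as [|s IH]; [cbn; lia|].
  rewrite cnt_S; destruct (simb X x s) eqn:E; auto.
  intros H; destruct (Nat.eq_dec (cnt X x s) j); [eauto | apply IH; lia].
Qed.

Lemma card_ge_le X x m n : card_ge X x n -> m <= n -> card_ge X x m.
Proof. intros [s H] Hm; exists s; lia. Qed.

Lemma card_ge_congr X x x' n : bequiv X -> sim X x x' -> card_ge X x n -> card_ge X x' n.
Proof. intros HX H [s Hs]; exists s; now rewrite <- (cnt_congr X x x'). Qed.

Lemma card_ge_list X x l :
  NoDup l -> (forall y, In y l -> sim X x y) -> card_ge X x (length l).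
Proof.
  intros Hl Hs; exists (S (list_max l)); rewrite cnt_filter.
  apply NoDup_incl_length; auto; intros y Hy; apply filter_In; split; [|now apply Hs].
  apply in_seq.
  assert (H := proj1 (list_max_le l (list_max l)) (Nat.le_refl _)).
  rewrite Forall_forall in H; specialize (H y Hy); lia.
Qed.

Lemma card_ge_list_inv X x n :
  card_ge X x n -> exists l, NoDup l /\ n <= length l /\ forall y, In y l -> sim X x y.
Proof.
  intros [s Hs]; rewrite cnt_filter in Hs; exists (filter (simb X x) (seq 0 s)).
  split; [apply NoDup_filter, seq_NoDup|]; split; auto.
  now intros y Hy; apply filter_In in Hy.
Qed.

Lemma inf_card X x : inf X x <-> forall n, card_ge X x n.
Proof.
  split.
  - intros H; induction n as [|n [s Hs]]; [exists 0; lia|].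
    destruct (H s) as (y & Hy & E); exists (S y).
    assert (H' := cnt_mono X x s y Hy); rewrite cnt_S, E; lia.
  - intros H s; apply NNPP; intros H'.
    assert (B : forall s', cnt X x s' <= s).
    { intros s'; destruct (le_ge_dec s' s) as [Hle|Hge].
      - generalize (cnt_le X x s'); lia.
      - induction Hge as [|s' Hs IH]; [apply cnt_le|].
        rewrite cnt_S; destruct (simb X x s') eqn:E; auto.
        destruct H'; exists s'; auto. }
    destruct (H (S s)) as [s' Hs]; specialize (B s'); lia.
Qed.

Lemma inf_congr X x y : bequiv X -> sim X x y -> inf X x -> inf X y.
Proof. rewrite !inf_card; intros HX H Hx n; eapply card_ge_congr; eauto. Qed.

Lemma inf_univ X x : inf X x -> bu X x = true.
Proof. intros H; destruct (H 0) as (y & _ & E); now apply sim_univ_l in E. Qed.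

Lemma not_inf_bound X x : ~ inf X x -> exists s, forall y, s <= y -> simb X x y = false.
Proof.
  intros H; apply NNPP; intros H'; apply H; intros s; apply NNPP; intros H''; apply H'.
  exists s; intros y Hy; apply not_true_is_false; intros E; apply H''; eauto.
Qed.

Lemma bound_card X x s n :
  (forall y, s <= y -> simb X x y = false) -> card_ge X x n -> n <= s.
Proof.
  intros Hb [s' Hs]; enough (cnt X x s' <= s) by lia; clear Hs.
  destruct (le_ge_dec s' s) as [Hle|Hge].
  - generalize (cnt_le X x s'); lia.
  - induction Hge as [|s' Hs IH]; [apply cnt_le|]; now rewrite cnt_S, Hb.
Qed.

(** * Embeddings and counting of classes *)

Definition emb (X Y : bstr) (h : nat -> nat) : Prop := is_embedding (to_es X) (to_es Y) h.

Section Emb.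
Variables (X Y : bstr) (HX : bequiv X) (HY : bequiv Y) (h : nat -> nat) (Hh : emb X Y h).

Lemma emb_univ x : bu X x = true -> bu Y (h x) = true.
Proof. apply Hh. Qed.

Lemma emb_sim x y : sim X x y -> sim Y (h x) (h y).
Proof.
  rewrite !sim_iff; intros (H1 & H2 & H3).
  split; [|split]; try now apply emb_univ.
  now apply (proj2 (proj2 Hh)).
Qed.

Lemma emb_sim_inv x y :
  bu X x = true -> bu X y = true -> sim Y (h x) (h y) -> sim X x y.
Proof.
  rewrite !sim_iff; intros H1 H2 (_ & _ & H3); repeat split; auto.
  now apply (proj2 (proj2 Hh)).
Qed.

Lemma emb_inj x y : bu X x = true -> bu X y = true -> h x = h y -> x = y.
Proof. apply Hh. Qed.

Lemma emb_card x n : card_ge X x n -> card_ge Y (h x) n.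
Proof.
  intros H; apply card_ge_list_inv in H as (l & Hl & Hn & Hs).
  apply card_ge_le with (length (map h l)); [|now rewrite length_map].
  apply card_ge_list.
  - apply NoDup_map_NoDup_ForallPairs; auto.
    intros a b Ha Hb; apply emb_inj; [apply (sim_univ_l X a x) | apply (sim_univ_l X b x)];
      apply sim_sym; auto.
  - intros y Hy; apply in_map_iff in Hy as (z & <- & Hz); apply emb_sim; auto.
Qed.

Lemma emb_inf x : inf X x -> inf Y (h x).
Proof. rewrite !inf_card; eauto using emb_card. Qed.
End Emb.

Lemma emb_comp X Y Z f g : emb X Y f -> emb Y Z g -> emb X Z (fun x => g (f x)).
Proof.
  intros (f1 & f2 & f3) (g1 & g2 & g3); split; [auto | split].
  - intros x y Hx Hy E; apply f2, g2; auto.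
  - intros x y Hx Hy; rewrite f3 by auto; apply g3; auto.
Qed.

Definition Indep (X : bstr) (l : list nat) : Prop :=
  NoDup l /\ (forall x, In x l -> bu X x = true) /\
  forall x y, In x l -> In y l -> sim X x y -> x = y.

(** Pigeonhole: inequivalent elements have inequivalent images, so choosing for each image an
    equivalent member of [B] is injective on [l]. *)
Lemma Indep_bound X Y h l k :
  bequiv Y -> emb X Y h -> Indep X l ->
  (exists B, length B <= k /\ forall x, In x l -> exists y, In y B /\ sim Y (h x) y) ->
  length l <= k.
Proof.
  intros HY Hh (Hl & Hu & Hi) (B & Hk & HB).
  set (c x := epsilon (inhabits 0) (fun y => In y B /\ sim Y (h x) y)).
  assert (Hc : forall x, In x l -> In (c x) B /\ sim Y (h x) (c x)).
  { intros x Hx; apply (epsilon_spec (inhabits 0) (fun y => In y B /\ sim Y (h x) y)); auto. }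
  rewrite <- (length_map c l); apply Nat.le_trans with (length B); auto.
  apply NoDup_incl_length.
  - apply NoDup_map_NoDup_ForallPairs; auto; intros x y Hx Hy E.
    apply Hi; auto; apply (emb_sim_inv X Y h Hh); auto.
    apply (sim_trans Y HY) with (c x); [apply Hc; auto|].
    rewrite E; apply (sim_sym Y HY), Hc; auto.
  - intros y Hy; apply in_map_iff in Hy as (x & <- & Hx); now apply Hc.
Qed.

Lemma Many_list X Q k :
  bequiv X -> Many X Q -> exists l, length l = k /\ Indep X l /\ forall x, In x l -> Q x.
Proof.
  intros HX H; induction k as [|k (l & H1 & (H2 & H3 & H4) & H5)].
  - exists []; split; auto; split; [|intros x []].
    split; [constructor|]; split; intros x; intros; contradiction.
  - destruct (H (list_max l)) as (x & Hx & HQ & Hn).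
    assert (Hl : forall y, In y l -> ~ sim X x y).
    { intros y Hy; apply Hn.
      assert (Hm := proj1 (list_max_le l (list_max l)) (Nat.le_refl _)).
      rewrite Forall_forall in Hm; auto. }
    exists (x :: l); split; [simpl; auto|]; split; [split; [|split]|].
    + constructor; auto; intros Hi; apply (Hl x Hi), sim_refl; auto.
    + intros y [<-|Hy]; auto.
    + intros y z [<-|Hy] [<-|Hz] E; auto.
      * now apply Hl in E.
      * apply (sim_sym X HX) in E; now apply Hl in E.
    + intros y [<-|Hy]; auto.
Qed.

Lemma not_Many X Q :
  ~ Many X Q ->
  exists n, forall x, bu X x = true -> Q x -> exists y, y <= n /\ sim X x y.
Proof.
  intros H; apply NNPP; intros H'; apply H; intros n; apply NNPP; intros H''; apply H'.
  exists n; intros x Hx HQ; apply NNPP; intros H3; apply H''; exists x.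
  repeat split; auto; intros y Hy E; eauto.
Qed.

Lemma Many_emb X Y h (Q Q' : nat -> Prop) :
  bequiv X -> bequiv Y -> emb X Y h -> (forall x, Q x -> Q' (h x)) ->
  Many X Q -> Many Y Q'.
Proof.
  intros HX HY Hh HQ HM; apply NNPP; intros H; apply not_Many in H as [n Hn].
  (* All classes of [Y] with [Q'] meet the [n + 1] numbers up to [n], so [n + 2] classes of [X] are
     one too many. *)
  destruct (Many_list X Q (S (S n)) HX HM) as (l & Hlen & HI & HlQ).
  assert (length l <= S n); [|lia].
  apply (Indep_bound X Y h); auto; exists (seq 0 (S n)); rewrite length_seq; split; auto.
  intros x Hx; destruct (Hn (h x)) as (y & Hy & E); auto.
  - apply (emb_univ X Y h Hh), HI; auto.
  - exists y; split; auto; apply in_seq; lia.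
Qed.

Lemma finite_list_of (P : nat -> Prop) n :
  exists l, NoDup l /\ forall x, In x l <-> x <= n /\ P x.
Proof.
  exists (filter (fun x => if excluded_middle_informative (P x) then true else false)
            (seq 0 (S n))).
  split; [apply NoDup_filter, seq_NoDup|]; intros x; rewrite filter_In, in_seq.
  destruct (excluded_middle_informative (P x)); intuition (lia || discriminate).
Qed.

Lemma comp_bu O X f : bcomp O X -> Comp O f -> CompB O (fun n => bu X (f n)).
Proof. intros [H1 H2] Hf; comp. Qed.

Lemma comp_simb O X f g :
  bcomp O X -> Comp O f -> Comp O g -> CompB O (fun n => simb X (f n) (g n)).
Proof. intros [H1 H2] Hf Hg; unfold simb; comp. Qed.

Lemma comp_cnt O X f g :
  bcomp O X -> Comp O f -> Comp O g -> Comp O (fun n => cnt X (f n) (g n)).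
Proof. intros [H1 H2] Hf Hg; unfold cnt, simb; comp. Qed.

Lemma bcomp_lift O X : bcomp empty_oracle X -> bcomp O X.
Proof. intros [H1 H2]; split; now apply comp_lift. Qed.

Ltac comp_struct ::=
  match goal with
  | H : bcomp ?O ?X |- CompB ?O (fun n => bu ?X (@?f n)) => apply (comp_bu O X f H)
  | H : bcomp ?O ?X |- CompB ?O (fun n => simb ?X (@?f n) (@?g n)) =>
      apply (comp_simb O X f g H)
  | H : bcomp ?O ?X |- Comp ?O (fun n => cnt ?X (@?f n) (@?g n)) =>
      apply (comp_cnt O X f g H)
  end.

(** * Constructing embeddings *)

(* Classes of [X] meeting [L] are sent where [L] says; for the others, listed by
   their least elements, a fresh class of [Y] is searched among the [fst' w] with
   [W x w]. The [j]-th element of a class goes to the [j]-th element of its target. *)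
Section Construction.
Variables (O : oracle) (X Y : bstr) (L : list (nat * nat)) (W : nat -> nat -> bool).

Definition special (x : nat) : bool := existsb (fun p => simb X x (fst p)) L.

Fixpoint lookup (l : list (nat * nat)) (x : nat) : nat :=
  match l with
  | [] => 0
  | p :: l => if simb X x (fst p) then snd p else lookup l x
  end.

Lemma special_spec x : special x = true <-> exists p, In p L /\ sim X x (fst p).
Proof. unfold special; rewrite existsb_exists; reflexivity. Qed.

Lemma lookup_spec l x :
  existsb (fun p => simb X x (fst p)) l = true ->
  exists p, In p l /\ sim X x (fst p) /\ lookup l x = snd p.
Proof.
  induction l as [|p l IH]; simpl; [discriminate|].
  destruct (simb X x (fst p)) eqn:E; [intros _; exists p; auto|].
  simpl; intros H; destruct (IH H) as (p' & H1 & H2); eauto.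
Qed.

Lemma comp_special f : bcomp O X -> Comp O f -> CompB O (fun n => special (f n)).
Proof. intros HX Hf; unfold special; induction L as [|p l IH]; simpl; comp. Qed.

Lemma comp_lookup l f : bcomp O X -> Comp O f -> Comp O (fun n => lookup l (f n)).
Proof. intros HX Hf; induction l as [|p l IH]; simpl; comp. Qed.

(** The second component of [w] is room for a certificate, such as a stage by which enough members
    of the class of [fst' w] have been counted. *)
Hypotheses (HX : bequiv X) (HY : bequiv Y) (CX : bcomp O X) (CY : bcomp O Y)
  (CW : CompB2 O W)
  (HL : forall p n, In p L -> card_ge X (fst p) n -> card_ge Y (snd p) n)
  (HLi : forall p p', In p L -> In p' L -> sim Y (snd p) (snd p') -> sim X (fst p) (fst p'))
  (HW : forall x w n, bu X x = true -> special x = false -> W x w = true ->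
     card_ge X x n -> card_ge Y (fst' w) n)
  (HE : forall x n, bu X x = true -> special x = false ->
     exists w, W x w = true /\ forall y, y <= n -> ~ sim Y (fst' w) y).

Lemma special_congr x x' : sim X x x' -> special x = special x'.
Proof.
  intros H; unfold special; clear HL HLi HW HE; induction L as [|p l IH]; simpl; auto.
  now rewrite IH, (simb_congr X HX x x').
Qed.

Lemma lookup_congr l x x' : sim X x x' -> lookup l x = lookup l x'.
Proof.
  intros H; induction l as [|p l IH]; simpl; auto.
  now rewrite IH, (simb_congr X HX x x').
Qed.

Lemma embedding_of_targets tg :
  Comp O tg ->
  (forall x x', sim X x x' -> tg x = tg x') ->
  (forall x x', bu X x = true -> bu X x' = true -> sim Y (tg x) (tg x') -> sim X x x') ->
  (forall x n, bu X x = true -> card_ge X x n -> card_ge Y (tg x) n) ->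
  O_computable_embedding O (to_es X) (to_es Y).
Proof.
  intros Ctg Htg Hinj Hcard.
  destruct (comp_search O (fun x y => negb (bu X x) ||
    (simb Y (tg x) y && (cnt Y (tg x) y =? cnt X x x)))) as (f & Cf & Hf).
  { comp. }
  { intros x; destruct (bu X x) eqn:E; [|exists 0; reflexivity].
    (* The class of [x] contains [x] besides the [cnt X x x] earlier members, so position
       [cnt X x x] is occupied in the target as well. *)
    destruct (Hcard x (S (cnt X x x)) E) as [s Hs].
    - exists (S x); rewrite cnt_S, (sim_refl X HX x E); auto.
    - destruct (cnt_hit _ _ _ _ Hs) as (y & Hy & Ey); exists y; simpl.
      now rewrite Hy, Ey, Nat.eqb_refl. }
  assert (Hf' : forall x, bu X x = true ->
    sim Y (tg x) (f x) /\ cnt Y (tg x) (f x) = cnt X x x).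
  { intros x E; destruct (Hf x) as [H _]; rewrite E in H; simpl in H.
    apply andb_true_iff in H as [H1 H2]; now rewrite Nat.eqb_eq in H2. }
  destruct Cf as [p Hp]; exists p, f; split; auto.
  assert (back : forall x y, bu X x = true -> bu X y = true ->
    sim Y (f x) (f y) -> sim X x y).
  { intros x y Ex Ey H; apply Hinj; auto.
    apply (sim_trans Y HY) with (f x); [now apply Hf'|].
    apply (sim_trans Y HY) with (f y); auto.
    now apply (sim_sym Y HY), Hf'. }
  split; [|split]; cbn.
  - intros x Ex; apply (sim_univ_l Y _ (tg x)), (sim_sym Y HY); now apply Hf'.
  - intros x y Ex Ey E.
    assert (S : sim X x y).
    { apply back; auto; rewrite E; apply (sim_refl Y HY).
      apply (sim_univ_l Y _ (tg y)), (sim_sym Y HY); now apply Hf'. }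
    assert (E' : cnt X x x = cnt X x y).
    { rewrite (cnt_congr X x y y HX S).
      destruct (Hf' x Ex) as [_ <-], (Hf' y Ey) as [_ <-]; now rewrite E, (Htg x y S). }
    assert (Sx : simb X x x = true) by now apply (sim_refl X HX).
    assert (Sy : simb X x y = true) by exact S.
    destruct (Nat.lt_trichotomy x y) as [Hl|[Hl|Hl]]; auto; exfalso.
    + apply (cnt_mono X x) in Hl; rewrite cnt_S, Sx in Hl; lia.
    + apply (cnt_mono X x) in Hl; rewrite cnt_S, Sy in Hl; lia.
  - intros x y Ex Ey; split; intros H.
    + assert (S : sim X x y) by (apply sim_iff; auto).
      apply (sim_iff Y); apply (sim_trans Y HY) with (tg x).
      * apply (sim_sym Y HY); now apply Hf'.
      * rewrite (Htg x y S); now apply Hf'.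
    + apply (sim_iff X), back; auto; apply sim_iff; split; [|split]; auto.
      * apply (sim_univ_l Y _ (tg x)), (sim_sym Y HY); now apply Hf'.
      * apply (sim_univ_l Y _ (tg y)), (sim_sym Y HY); now apply Hf'.
Qed.

Lemma computable_embedding : O_computable_embedding O (to_es X) (to_es Y).
Proof.
  assert (Cs := comp_special (fun z => fst' z) CX ltac:(comp)).
  (* [ld x] is the least member of the class of [x]; choosing targets through it makes them constant
     on classes. *)
  destruct (comp_search O (fun x y => negb (bu X x) || simb X x y)) as (ld & Cld & Hld).
  { comp. }
  { intros x; destruct (bu X x) eqn:E; [|exists 0; reflexivity].
    exists x; now apply sim_refl. }
  assert (ld_sim : forall x, bu X x = true -> sim X x (ld x)).
  { intros x E; destruct (Hld x) as [H _]; now rewrite E in H. }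
  assert (ld_congr : forall x x', sim X x x' -> ld x = ld x').
  { intros x x' H.
    assert (Ex := sim_univ_l X _ _ H).
    assert (Ex' := sim_univ_l X _ _ (sim_sym X HX _ _ H)).
    destruct (Hld x) as [H1 H2], (Hld x') as [H3 H4].
    rewrite Ex in H1, H2; rewrite Ex' in H3, H4; simpl in *.
    destruct (Nat.lt_trichotomy (ld x) (ld x')) as [Hl|[Hl|Hl]]; auto; exfalso.
    - specialize (H4 _ Hl); rewrite <- (simb_congr X HX x x') in H4; auto; congruence.
    - specialize (H2 _ Hl); rewrite (simb_congr X HX x x') in H2; auto; congruence. }
  destruct (comp_search O (fun z w => negb (bu X (fst' z)) || special (fst' z) ||
    (W (fst' z) w && ball (S (snd' z)) (fun y => negb (simb Y (fst' w) y)))))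
    as (g & Cg & Hg).
  { assert (Cs' := comp_special (fun z => fst' (fst' z)) CX ltac:(comp)); comp. }
  { intros z; destruct (bu X (fst' z)) eqn:E; [|exists 0; reflexivity].
    destruct (special (fst' z)) eqn:E'; [exists 0; reflexivity|].
    destruct (HE (fst' z) (snd' z) E E') as (w & Hw & Hy); exists w.
    rewrite Hw; cbn [negb orb andb].
    apply ball_spec; intros y Hy'; apply negb_true_iff, not_true_is_false, Hy; lia. }
  (* [G x] bounds all tabulated targets and all targets [z x'] with [x' < x]. A target inequivalent
     to every number up to [G x] is therefore new. *)
  set (B := list_max (map snd L)).
  set (G x := prec B (fun x n => n + fst' (g (pair x n))) x).
  set (z x := fst' (g (pair x (G x)))).
  assert (Hz : forall x, bu X x = true -> special x = false ->
    (forall n, card_ge X x n -> card_ge Y (z x) n) /\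
    (forall y, y <= G x -> ~ sim Y (z x) y) /\ z x <= G (S x)).
  { intros x E E'; destruct (Hg (pair x (G x))) as [H _].
    rewrite fst_pair, snd_pair, E, E' in H; cbn [negb orb] in H.
    apply andb_true_iff in H as [H1 H2]; split; [|split].
    - intros n; now apply HW.
    - intros y Hy Hs; rewrite ball_spec in H2; specialize (H2 y ltac:(lia)).
      unfold sim, z in Hs; rewrite Hs in H2; discriminate.
    - unfold G at 1; simpl; fold (G x); fold (z x); lia. }
  assert (G_mono : forall x x', x <= x' -> G x <= G x').
  { induction 1 as [|x' _ IH]; auto; unfold G at 2; simpl; fold (G x'); lia. }
  assert (HB : forall p x, In p L -> snd p <= G x).
  { intros p x Hp; apply Nat.le_trans with (G 0); [|apply G_mono; lia].
    assert (H := proj1 (list_max_le (map snd L) B) (Nat.le_refl _)).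
    rewrite Forall_forall in H; apply H, in_map, Hp. }
  assert (Cz : Comp O z).
  { unfold z, G; comp. }
  set (tg x := if special x then lookup L x else z (ld x)).
  assert (Hsp : forall x, bu X x = true -> special x = false ->
    bu X (ld x) = true /\ special (ld x) = false).
  { intros x E E'; split; [|rewrite <- (special_congr x); auto].
    apply (sim_univ_l X _ x), (sim_sym X HX); auto. }
  assert (zinj : forall x x', bu X x = true -> special x = false ->
    bu X x' = true -> special x' = false -> x < x' -> ~ sim Y (z x') (z x)).
  { intros x x' E1 E2 E3 E4 Hl; apply Hz; auto.
    apply Nat.le_trans with (G (S x)); [now apply Hz | apply G_mono; lia]. }
  apply (embedding_of_targets tg).
  - unfold tg; apply comp_if; [apply (comp_special (fun x => x)) | apply (comp_lookup L (fun x => x)) |];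
      auto; comp.
  - intros x x' H; unfold tg.
    now rewrite (special_congr x x'), (lookup_congr L x x'), (ld_congr x x').
  - intros x x' Ex Ex'; unfold tg.
    destruct (special x) eqn:Sx, (special x') eqn:Sx'.
    + apply lookup_spec in Sx as (p & Hp & S1 & ->).
      apply lookup_spec in Sx' as (p' & Hp' & S2 & ->).
      intros H; apply (sim_trans X HX) with (fst p); auto.
      apply (sim_trans X HX) with (fst p'); [auto | now apply (sim_sym X HX)].
    + apply lookup_spec in Sx as (p & Hp & S1 & ->); intros H; exfalso.
      apply (sim_sym Y HY) in H; revert H.
      destruct (Hsp x' Ex' Sx') as [H1 H2]; apply Hz; auto.
    + apply lookup_spec in Sx' as (p & Hp & S1 & ->); intros H; exfalso; revert H.
      destruct (Hsp x Ex Sx) as [H1 H2]; apply Hz; auto.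
    + destruct (Hsp x Ex Sx) as [H1 H2], (Hsp x' Ex' Sx') as [H3 H4]; intros H.
      assert (El : ld x = ld x').
      { destruct (Nat.lt_trichotomy (ld x) (ld x')) as [Hl|[Hl|Hl]]; auto; exfalso.
        - apply (sim_sym Y HY) in H; revert H; now apply zinj.
        - revert H; now apply zinj. }
      apply (sim_trans X HX) with (ld x); auto.
      rewrite El; apply (sim_sym X HX); auto.
  - intros x n Ex Hn; unfold tg; destruct (special x) eqn:Sx.
    + apply lookup_spec in Sx as (p & Hp & S1 & ->).
      apply HL; auto; now apply (card_ge_congr X x).
    + destruct (Hsp x Ex Sx) as [H1 H2]; apply Hz; auto.
      apply (card_ge_congr X x); auto.
Qed.
End Construction.

(** For mere existence, [W] itself is taken as the oracle, so it may be any classical condition. *)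
Lemma embedding_exists X Y L W :
  bequiv X -> bequiv Y -> bcomp empty_oracle X -> bcomp empty_oracle Y ->
  (forall p n, In p L -> card_ge X (fst p) n -> card_ge Y (snd p) n) ->
  (forall p p', In p L -> In p' L -> sim Y (snd p) (snd p') -> sim X (fst p) (fst p')) ->
  (forall x w n, bu X x = true -> special X L x = false -> W x w = true ->
     card_ge X x n -> card_ge Y (fst' w) n) ->
  (forall x n, bu X x = true -> special X L x = false ->
     exists w, W x w = true /\ forall y, y <= n -> ~ sim Y (fst' w) y) ->
  embeds (to_es X) (to_es Y).
Proof.
  intros HX HY CX CY H1 H2 H3 H4.
  set (O z := W (fst' z) (snd' z) = true).
  destruct (computable_embedding O X Y L W) as (p & f & _ & Hf); auto using bcomp_lift.
  - exists COracle; intros z; destruct (W (fst' z) (snd' z)) eqn:E; constructor; auto.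
    unfold O; rewrite E; discriminate.
  - now exists f.
Qed.

(** * Structures whose degree is 0' *)

Definition classical_bool (P : Prop) : bool :=
  if excluded_middle_informative P then true else false.

Lemma classical_bool_spec P : classical_bool P = true <-> P.
Proof.
  unfold classical_bool; destruct (excluded_middle_informative P); split; auto; discriminate.
Qed.

Lemma eventually_all k (P : nat -> nat -> Prop) :
  (forall i, i < k -> exists t, forall s, t <= s -> P i s) ->
  exists t, forall i, i < k -> forall s, t <= s -> P i s.
Proof.
  induction k as [|k IH]; intros H; [exists 0; intros; lia|].
  destruct IH as [t Ht]; [intros i Hi; apply H; lia|].
  destruct (H k (Nat.lt_succ_diag_r k)) as [t' Ht'].
  exists (max t t'); intros i Hi s Hs.
  destruct (Nat.eq_dec i k) as [->|]; [apply Ht' | apply Ht]; lia.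
Qed.

Lemma pair_bound a t : exists m, forall z, fst' z = a -> snd' z < t -> z < m.
Proof.
  destruct (eventually_all t (fun j s => pair a j < s)) as [m Hm].
  - intros j _; exists (S (pair a j)); lia.
  - exists m; intros z <- Hz; rewrite <- (pair_eta z); now apply Hm.
Qed.

Lemma special_false X L x p :
  special X L x = false -> In p L -> ~ sim X x (fst p).
Proof.
  intros H Hp E; apply not_true_iff_false in H; apply H, special_spec; eauto.
Qed.

(** The table copies [h] on all elements up to a bound that every class with [P] meets; [h] already
    respects sizes and separates classes. *)
Lemma exceptions_list X Y h (P : nat -> Prop) :
  bequiv X -> bequiv Y -> emb X Y h -> (forall x y, sim X x y -> P x -> P y) ->
  ~ Many X P ->
  exists L,
    (forall x, bu X x = true -> special X L x = false -> ~ P x) /\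
    (forall p n, In p L -> card_ge X (fst p) n -> card_ge Y (snd p) n) /\
    (forall p p', In p L -> In p' L -> sim Y (snd p) (snd p') -> sim X (fst p) (fst p')).
Proof.
  intros HX HY Hh HP HM; apply not_Many in HM as [n Hn].
  destruct (finite_list_of (fun x => bu X x = true) n) as (l & _ & Hl).
  exists (map (fun x => (x, h x)) l); split; [|split].
  - intros x Hx Hs HPx; destruct (Hn x Hx HPx) as (y & Hy & E).
    apply (special_false _ _ _ (y, h y) Hs); auto.
    apply (in_map (fun x => (x, h x))), Hl; split; auto.
    apply (sim_univ_l X y x), sim_sym; auto.
  - intros p m Hp; apply in_map_iff in Hp as (x & <- & Hx); simpl.
    now apply emb_card.
  - intros p p' Hp Hp'; apply in_map_iff in Hp as (x & <- & Hx).
    apply in_map_iff in Hp' as (x' & <- & Hx'); simpl.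
    apply (emb_sim_inv X Y h Hh); [now apply Hl in Hx | now apply Hl in Hx'].
Qed.

(** Classes outside the table have fewer than [m] elements, so a class of [Y] in which [m - 1]
    elements have been counted is a safe target, and this is found by computable search. *)
Lemma finite_classes_embedding X Y h m :
  bequiv X -> bequiv Y -> bcomp empty_oracle X -> bcomp empty_oracle Y -> emb X Y h ->
  ~ Many X (fun x => card_ge X x m) ->
  (m <> 0 -> Many Y (fun y => card_ge Y y (Nat.pred m))) ->
  O_computable_embedding empty_oracle (to_es X) (to_es Y).
Proof.
  intros HX HY CX CY Hh HM HMY.
  destruct (exceptions_list X Y h _ HX HY Hh
    (fun x y E => card_ge_congr X x y m HX E) HM) as (L & H1 & H2 & H3).
  apply (computable_embedding empty_oracle X Y L
    (fun _ w => Nat.pred m <=? cnt Y (fst' w) (snd' w))); auto.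
  - comp.
  - intros x w n Hx Hs Hw Hn; exists (snd' w); apply Nat.leb_le in Hw.
    assert (~ m <= n); [|lia].
    intros Hmn; apply (H1 x Hx Hs); eapply card_ge_le; eauto.
  - intros x n Hx Hs; destruct (HMY) with (n := n) as (y & _ & [s Hs'] & Hy).
    (* For [m = 0] every class satisfies the property, so none lies outside the table. *)
    + intros ->; apply (H1 x Hx Hs); exists 0; lia.
    + exists (pair y s); rewrite fst_pair, snd_pair; split; auto; now apply Nat.leb_le.
Qed.

Lemma halting_embedding X Y h :
  bequiv X -> bequiv Y -> bcomp empty_oracle X -> bcomp empty_oracle Y -> emb X Y h ->
  ~ Many X (inf X) -> (forall m, Many Y (fun y => card_ge Y y m)) ->
  O_computable_embedding halting_set (to_es X) (to_es Y).
Proof.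
  intros HX HY CX CY Hh HM HMY.
  destruct (exceptions_list X Y h _ HX HY Hh
    (fun x y E => inf_congr X x y HX E) HM) as (L & H1 & H2 & H3).
  (* [b] tells whether the class of [fst' z] has a member at or beyond [snd' z]. *)
  destruct (halting_sigma1 (fun z y => (snd' z <=? y) && simb X (fst' z) y)) as (b & Cb & Hb).
  { comp. }
  assert (CX' := bcomp_lift halting_set X CX); assert (CY' := bcomp_lift halting_set Y CY).
  (* No member of the class of [x] is at or beyond [need x], which therefore also bounds its
     size. *)
  destruct (comp_search halting_set (fun x s => negb (bu X x) || special X L x ||
    negb (b (pair x s)))) as (need & Cn & Hn).
  { assert (Cs := comp_special halting_set X L (fun z => fst' z) CX' ltac:(comp)); comp. }
  { intros x; destruct (bu X x) eqn:E; [|exists 0; reflexivity].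
    destruct (special X L x) eqn:E'; [exists 0; reflexivity|].
    destruct (not_inf_bound X x (H1 x E E')) as [s Hs]; exists s; cbn [negb orb].
    apply negb_true_iff, not_true_is_false; rewrite Hb; intros (y & Hy).
    rewrite fst_pair, snd_pair, andb_true_iff, Nat.leb_le in Hy.
    rewrite Hs in Hy; intuition discriminate. }
  apply (computable_embedding halting_set X Y L
    (fun x w => need x <=? cnt Y (fst' w) (snd' w))); auto.
  - comp.
  - intros x w n Hx Hs Hw Hc; exists (snd' w); apply Nat.leb_le in Hw.
    apply Nat.le_trans with (need x); auto.
    apply (bound_card X x); auto; intros y Hy; apply not_true_is_false; intros E.
    destruct (Hn x) as [H _]; rewrite Hx, Hs in H; cbn [negb orb] in H.
    apply negb_true_iff, not_true_iff_false in H; apply H, Hb; exists y.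
    rewrite fst_pair, snd_pair, E, andb_true_r; now apply Nat.leb_le.
  - intros x n Hx Hs; destruct (HMY (need x) n) as (y & _ & [s Hs'] & Hy).
    exists (pair y s); rewrite fst_pair, snd_pair; split; auto; now apply Nat.leb_le.
Qed.

(** The table takes care of the infinite classes of [X]; each remaining class is finite, and
    unboundedly large classes of [Y] suffice for it. *)
Lemma embeds_unbounded X Y L :
  bequiv X -> bequiv Y -> bcomp empty_oracle X -> bcomp empty_oracle Y ->
  (forall p, In p L -> inf Y (snd p)) ->
  (forall p p', In p L -> In p' L -> sim Y (snd p) (snd p') -> sim X (fst p) (fst p')) ->
  (forall x, inf X x -> special X L x = true) ->
  (forall m, Many Y (fun y => card_ge Y y m)) ->
  embeds (to_es X) (to_es Y).
Proof.
  intros HX HY CX CY H1 H2 H3 HM.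
  apply (embedding_exists X Y L (fun x w =>
    classical_bool (forall n, card_ge X x n -> card_ge Y (fst' w) n))); auto.
  - intros p n Hp _; apply (proj1 (inf_card Y (snd p))); auto.
  - intros x w n _ _ H; rewrite classical_bool_spec in H; auto.
  - intros x n Hx Hs.
    destruct (not_inf_bound X x) as [s Hb].
    { intros Hi; apply H3 in Hi; congruence. }
    destruct (HM s n) as (y & _ & Hc & Hy); exists (pair y 0).
    rewrite fst_pair; split; auto; apply classical_bool_spec; intros k Hk.
    apply card_ge_le with s; auto; now apply (bound_card X x).
Qed.

Lemma embeds_many_inf X Y :
  bequiv X -> bequiv Y -> bcomp empty_oracle X -> bcomp empty_oracle Y ->
  Many Y (inf Y) -> embeds (to_es X) (to_es Y).
Proof.
  intros HX HY CX CY HM.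
  apply (embedding_exists X Y [] (fun x w => classical_bool (inf Y (fst' w))));
    auto; try (intros p ? []; fail).
  - intros x w n _ _ H _; rewrite classical_bool_spec in H.
    now apply (proj1 (inf_card Y (fst' w))).
  - intros x n _ _; destruct (HM n) as (y & _ & Hi & Hy); exists (pair y 0).
    rewrite fst_pair; split; auto; now apply classical_bool_spec.
Qed.

(* The infinite classes of [X], represented by [l], together with finite classes
   number [n] given by [fin n]. *)
Section Ext.
Variables (X : bstr) (l : list nat) (fin : nat -> nat -> bool).

(** First component 0 marks a copy of the infinite classes, and [S n] marks the finite class number
    [n]. *)
Definition Ext : bstr := BStr
  (fun z => if fst' z =? 0 then existsb (fun y => simb X y (snd' z)) l
            else fin (Nat.pred (fst' z)) (snd' z))
  (fun z z' => (fst' z =? fst' z') && (negb (fst' z =? 0) || simb X (snd' z) (snd' z'))).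

Hypotheses (HX : bequiv X) (CX : bcomp empty_oracle X) (Cfin : CompB2 empty_oracle fin)
  (Hfin : forall n, exists t, forall j, t <= j -> fin n j = false)
  (Hle : forall n j, j <= n -> fin n j = true)
  (Hl : forall y, In y l -> inf X y)
  (Hl' : forall x, inf X x -> exists y, In y l /\ sim X y x)
  (HD : forall m, Many X (fun x => card_ge X x m)).

Lemma Ext_sim z z' :
  sim Ext z z' <->
  fst' z = fst' z' /\
  (fst' z = 0 -> sim X (snd' z) (snd' z') /\ exists y, In y l /\ sim X y (snd' z)) /\
  (fst' z <> 0 ->
     fin (Nat.pred (fst' z)) (snd' z) = true /\ fin (Nat.pred (fst' z)) (snd' z') = true).
Proof.
  rewrite sim_iff; cbn [bu br Ext]; rewrite andb_true_iff, Nat.eqb_eq, orb_true_iff.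
  rewrite negb_true_iff, Nat.eqb_neq; split.
  - intros (H1 & H2 & E & H3); rewrite <- E in H2; split; auto.
    destruct (Nat.eqb_spec (fst' z) 0) as [E0|E0]; split; intros; try tauto.
    split; [tauto|]; apply existsb_exists in H1; auto.
  - intros (E & H1 & H2); rewrite <- E.
    destruct (Nat.eqb_spec (fst' z) 0) as [E0|E0].
    + destruct (H1 E0) as (H3 & y & Hy & Hs).
      split; [|split; [|split; auto]]; apply existsb_exists; exists y; split; auto.
      now apply (sim_trans X HX) with (snd' z).
    + destruct (H2 E0); auto.
Qed.

Lemma Ext_equiv : bequiv Ext.
Proof.
  split; [|split]; cbn [es_univ es_rel to_es].
  - cbn; intros z H; rewrite Nat.eqb_refl; simpl.
    destruct (Nat.eqb_spec (fst' z) 0) as [E0|E0]; auto; simpl.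
    apply existsb_exists in H as (y & Hy & Hs); apply (sim_refl X HX).
    apply (sim_univ_l X _ y), (sim_sym X HX); auto.
  - cbn; intros z z' _ _; rewrite !andb_true_iff, !orb_true_iff, !Nat.eqb_eq; intros [E H].
    split; auto; rewrite <- E; destruct H; auto; right; now apply (sim_sym X HX).
  - cbn; intros x y z _ _ _; rewrite !andb_true_iff, !orb_true_iff, !Nat.eqb_eq.
    intros [E H] [E' H']; split; [congruence|].
    destruct H as [|H]; auto; rewrite E in *; destruct H' as [|H']; auto.
    right; now apply (sim_trans X HX) with (snd' y).
Qed.

Lemma Ext_comp : bcomp empty_oracle Ext.
Proof.
  split; cbn.
  - apply compB_if; [comp| |comp].
    clear Hl Hl'; induction l as [|y l' IH]; simpl; comp.
  - comp.
Qed.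

Lemma Ext_inf y x : In y l -> sim X y x -> inf Ext (pair 0 x).
Proof.
  intros Hy Hx s.
  destruct (inf_congr X y x HX Hx (Hl y Hy) s) as (w & Hw & E).
  exists (pair 0 w); split; [generalize (pair_ge 0 w); lia|].
  apply Ext_sim; rewrite !fst_pair, !snd_pair; split; auto; split; [|lia].
  intros _; split; eauto.
Qed.

Lemma Ext_inf_inv z : inf Ext z -> fst' z = 0 /\ exists y, In y l /\ sim X y (snd' z).
Proof.
  intros H; destruct (Nat.eq_dec (fst' z) 0) as [E0|E0].
  - split; auto; destruct (H 0) as (w & _ & E); apply Ext_sim in E; now apply E.
  - exfalso; destruct (Hfin (Nat.pred (fst' z))) as [t Ht].
    destruct (pair_bound (fst' z) t) as [m Hm].
    destruct (H m) as (w & Hw & E); apply Ext_sim in E as (E1 & _ & E2).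
    apply E2 in E0 as [_ E3]; specialize (Hm w); assert (~ t <= snd' w); [|lia].
    intros Hn; rewrite Ht in E3; auto; discriminate.
Qed.

Lemma Ext_class n j :
  fin n 0 = true -> fin n j = true -> sim Ext (pair (S n) 0) (pair (S n) j).
Proof.
  intros H0 Hj; apply Ext_sim; rewrite !fst_pair, !snd_pair; split; auto; split; [discriminate|].
  cbn [Nat.pred]; auto.
Qed.

Lemma Ext_card n js :
  NoDup js -> (forall j, In j js -> fin n j = true) ->
  card_ge Ext (pair (S n) 0) (length js).
Proof.
  intros Hn Hj; rewrite <- (length_map (pair (S n)) js); apply card_ge_list.
  - apply NoDup_map_NoDup_ForallPairs; auto.
    intros a b _ _ E; now apply pair_inj in E.
  - intros z Hz; apply in_map_iff in Hz as (j & <- & H); apply Ext_class; auto.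
    apply Hle; lia.
Qed.

Lemma Ext_unbounded m : Many Ext (fun x => card_ge Ext x m).
Proof.
  (* The summand [m] ensures the size; the summand [n] makes the class number exceed the first
     component of every [y <= n]. *)
  intros n; exists (pair (S (m + n)) 0); split; [|split].
  - apply (sim_univ_l Ext _ (pair (S (m + n)) 0)), Ext_class; apply Hle; lia.
  - rewrite <- (length_seq m 0); apply Ext_card; [apply seq_NoDup|].
    rewrite length_seq.
    intros j Hj; apply in_seq in Hj; apply Hle; lia.
  - intros y Hy E; apply Ext_sim in E as [E _]; rewrite fst_pair in E.
    generalize (fst_le y); lia.
Qed.

Lemma Ext_bi_embeddable : bi_embeddable (to_es Ext) (to_es X).
Proof.
  split.
  - apply (embeds_unbounded Ext X (map (fun y => (pair 0 y, y)) l));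
      auto using Ext_equiv, Ext_comp.
    + intros p Hp; apply in_map_iff in Hp as (y & <- & Hy); simpl; auto.
    + intros p p' Hp Hp' E; apply in_map_iff in Hp as (y & <- & Hy).
      apply in_map_iff in Hp' as (y' & <- & Hy'); simpl in *.
      apply Ext_sim; rewrite !fst_pair, !snd_pair; split; [reflexivity|].
      split; [intros _|lia]; split; [exact E|].
      exists y; split; [exact Hy|]; apply (sim_refl X HX), inf_univ, Hl, Hy.
    + intros x Hx; destruct (Ext_inf_inv x Hx) as (E & y & Hy & Hs).
      apply special_spec; exists (pair 0 y, y); split.
      * now apply (in_map (fun y => (pair 0 y, y))).
      * simpl; apply Ext_sim; rewrite fst_pair, snd_pair; split; auto.
        split; [|tauto]; intros _; split; [now apply (sim_sym X HX) | eauto].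
  - apply (embeds_unbounded X Ext (map (fun y => (y, pair 0 y)) l));
      auto using Ext_equiv, Ext_comp, Ext_unbounded.
    + intros p Hp; apply in_map_iff in Hp as (y & <- & Hy); simpl.
      apply (Ext_inf y); auto; apply (sim_refl X HX), inf_univ; auto.
    + intros p p' Hp Hp' E; apply in_map_iff in Hp as (y & <- & Hy).
      apply in_map_iff in Hp' as (y' & <- & Hy'); simpl in *.
      apply Ext_sim in E as (_ & E & _); rewrite !fst_pair, !snd_pair in E.
      apply E; reflexivity.
    + intros x Hx; destruct (Hl' x Hx) as (y & Hy & Hs).
      apply special_spec; exists (y, pair 0 y); split.
      * now apply (in_map (fun y => (y, pair 0 y))).
      * now apply (sim_sym X HX).
Qed.
End Ext.

Lemma infinite_representatives X :
  bequiv X -> ~ Many X (inf X) ->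
  exists l, Indep X l /\ (forall y, In y l -> inf X y) /\
    forall x, inf X x -> exists y, In y l /\ sim X y x.
Proof.
  intros HX HM; apply not_Many in HM as [n Hn].
  (* Taking the least member of each infinite class makes the representatives pairwise
     inequivalent. *)
  destruct (finite_list_of (fun y => inf X y /\ forall z, z < y -> ~ sim X y z) n)
    as (l & Hl & Hs).
  exists l; split; [split; [|split]|split]; auto.
  - intros y Hy; apply inf_univ; now apply Hs.
  - intros x y Hx Hy E; apply Hs in Hx as (_ & _ & Hx); apply Hs in Hy as (_ & _ & Hy).
    destruct (Nat.lt_trichotomy x y) as [H|[H|H]]; auto; exfalso.
    + apply (Hy x H); now apply (sim_sym X HX).
    + now apply (Hx y H).
  - intros y Hy; now apply Hs.
  - intros x Hx; destruct (Hn x (inf_univ X x Hx) Hx) as (y & Hy & E).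
    destruct (least_true (simb X x) y E) as (m & Hm & Em & Hlt).
    exists m; split; [|now apply (sim_sym X HX)].
    apply Hs; split; [lia|]; split; [now apply (inf_congr X x)|].
    intros z Hz E'.
    assert (E2 : simb X x z = true) by (apply (sim_trans X HX) with m; auto).
    rewrite Hlt in E2; auto; discriminate.
Qed.

Lemma halting_le_of_categorical X Y :
  bequiv X -> bcomp empty_oracle X -> ~ Many X (inf X) ->
  (forall m, Many X (fun x => card_ge X x m)) ->
  bi_emb_cat_for Y (to_es X) -> turing_le halting_set Y.
Proof.
  intros HX CX HM HD Hcat.
  destruct (infinite_representatives X HX HM) as (l & HI & Hl & Hl').
  set (finC n j := j <=? n).
  (* If [n] enters the halting set at stage [s], the second disjunct admits exactly the [j] with
     [s <= j < 2 * s]. These are [s] many and each is recognised at its own stage [j]. *)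
  set (finB n j := (j <=? n) || (HT j n && negb (HT (j / 2) n))).
  assert (CB : CompB2 empty_oracle finB) by (unfold finB; comp).
  assert (CC : CompB2 empty_oracle finC) by (unfold finC; comp).
  assert (LC : forall n j, j <= n -> finC n j = true) by (intros; now apply Nat.leb_le).
  assert (LB : forall n j, j <= n -> finB n j = true).
  { intros n j Hj; apply orb_true_iff; left; now apply Nat.leb_le. }
  assert (FC : forall n, exists t, forall j, t <= j -> finC n j = false).
  { intros n; exists (S n); intros j Hj; now apply Nat.leb_gt. }
  assert (FB : forall n, exists t, forall j, t <= j -> finB n j = false).
  { intros n; destruct (classic (halting_set n)) as [H|H].
    - apply HT_halting in H as [s Hs]; exists (2 * s + S n); intros j Hj.
      apply orb_false_iff; split; [apply Nat.leb_gt; lia|].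
      rewrite (HT_mono s (j / 2)); [apply andb_false_r | auto |].
      apply Nat.div_le_lower_bound; lia.
    - exists (S n); intros j Hj; apply orb_false_iff; split; [apply Nat.leb_gt; lia|].
      apply andb_false_iff; left; apply not_true_is_false; intros E.
      apply H, HT_halting; eauto. }
  set (B := Ext X l finB); set (C := Ext X l finC).
  assert (HB : bequiv B) by now apply Ext_equiv.
  assert (HC : bequiv C) by now apply Ext_equiv.
  destruct (Hcat (to_es B) (to_es C)) as [(p & f & Hp & Hf) _].
  1, 2: apply computable_to_es; auto; now apply Ext_comp.
  1, 2: now apply Ext_bi_embeddable.
  assert (Bu : forall n, bu B (pair (S n) 0) = true).
  { intros n; apply (sim_univ_l B _ (pair (S n) 0)).
    apply Ext_class; auto; apply LB; lia. }
  (* A finite class sent to an infinite one would leave [length l + 1] classes of [B] for [length l]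
     infinite classes of [C]. *)
  assert (Hz : forall n, fst' (f (pair (S n) 0)) <> 0).
  { intros n E0.
    assert (length (pair (S n) 0 :: map (pair 0) l) <= length l);
      [|simpl in *; rewrite length_map in *; lia].
    apply (Indep_bound B C f); auto.
    - destruct HI as (HI1 & HI2 & HI3); split; [|split].
      + constructor.
        * intros H; apply in_map_iff in H as (y & E & _); apply pair_inj in E; lia.
        * apply NoDup_map_NoDup_ForallPairs; auto.
          intros a b _ _ E; now apply pair_inj in E.
      + intros x [<-|H]; auto; apply in_map_iff in H as (y & <- & Hy).
        apply inf_univ, (Ext_inf X l finB) with (y := y); auto; now apply sim_refl; auto.
      + assert (A : forall y, ~ sim B (pair (S n) 0) (pair 0 y)).
        { intros y E; apply Ext_sim in E as [E _]; auto; rewrite !fst_pair in E; discriminate. }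
        intros x y [<-|Hx] [<-|Hy] E; auto.
        * apply in_map_iff in Hy as (y' & <- & Hy); now apply A in E.
        * apply in_map_iff in Hx as (x' & <- & Hx).
          apply (sim_sym B HB) in E; now apply A in E.
        * apply in_map_iff in Hy as (y' & <- & Hy); apply in_map_iff in Hx as (x' & <- & Hx).
          apply Ext_sim in E as (_ & E & _); auto; rewrite !fst_pair, !snd_pair in E.
          f_equal; apply HI3; auto; now apply E.
    - exists (map (pair 0) l); rewrite length_map; split; auto; intros x Hx.
      assert (G : exists y, In y l /\ fst' (f x) = 0 /\ sim X y (snd' (f x))).
      { destruct Hx as [<-|Hx].
        - assert (E := sim_refl C HC _ (emb_univ B C f Hf _ (Bu n))).
          apply Ext_sim in E as (_ & E & _); auto; destruct (E E0) as (_ & y & Hy & E').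
          eauto.
        - apply in_map_iff in Hx as (x' & <- & Hx).
          destruct (Ext_inf_inv X l finC HX FC (f (pair 0 x'))) as (E & y & Hy & E'); eauto.
          apply (emb_inf B C HB f Hf), (Ext_inf X l finB) with (y := x'); auto.
          apply sim_refl; auto; now apply HI. }
      destruct G as (y & Hy & E & E'); exists (pair 0 y); split; [now apply in_map|].
      apply Ext_sim; auto; rewrite fst_pair, snd_pair; split; auto; split; [|tauto].
      intros _; split; [now apply (sim_sym X HX) | eauto]. }
  assert (Cf : Comp Y (fun n => f (pair (S n) 0))).
  { destruct (comp_pair Y (fun n => S n) (fun _ => 0) ltac:(comp) ltac:(comp)) as [r Hr].
    exists (CComp p r); intros n; econstructor; [apply Hr | apply Hp, Bu]. }
  (* The first component of the image is the size of its class in [C], hence a bound on the stage at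
     which [n] can enter. *)
  apply (decidable_of_compB Y (fun n => HT (fst' (f (pair (S n) 0))) n)); [comp|].
  intros n; split; [intros H; apply HT_halting; eauto|].
  intros H; apply HT_halting in H as [s0 Hs0].
  destruct (least_true (fun s => HT s n) s0 Hs0) as (s & _ & Hs & Hlt); clear s0 Hs0.
  apply HT_mono with s; auto; specialize (Hz n).
  assert (H1 : card_ge B (pair (S n) 0) s).
  { rewrite <- (length_seq s s); apply (Ext_card X l finB); auto using seq_NoDup.
    intros j Hj; apply in_seq in Hj; apply orb_true_iff; right.
    rewrite (HT_mono s j), Hlt; auto; [|lia].
    apply Nat.Div0.div_lt_upper_bound; lia. }
  apply (emb_card B C HB f Hf), card_ge_list_inv in H1 as (ls & Hn & Hlen & Hin).
  destruct (fst' (f (pair (S n) 0))) as [|i] eqn:Ei; [lia|].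
  apply Nat.le_trans with (length ls); auto.
  assert (El : length (map (pair (S i)) (seq 0 (S i))) = S i)
    by now rewrite length_map, length_seq.
  rewrite <- El; apply NoDup_incl_length; auto; intros z Hzl; apply Hin, Ext_sim in Hzl as (E1 & _ & E2); auto.
  rewrite Ei in *; destruct E2 as [_ E2]; [lia|].
  rewrite <- (pair_eta z), <- E1; apply in_map, in_seq; apply Nat.leb_le in E2; simpl in E2; lia.
Qed.

(** * Infinitely many infinite classes *)

(* The value [0] means that no [a i] with [i < k] exceeds [2 * e]. *)
Definition first_above (e : nat) (a : nat -> nat) (k : nat) : nat :=
  prec 0 (fun i r => if r =? 0 then (if 2 * e <? a i then a i else 0) else r) k.

Lemma first_above_ext e a a' k :
  (forall i, i < k -> a i = a' i) -> first_above e a k = first_above e a' k.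
Proof.
  induction k as [|k IH]; intros H; [reflexivity|].
  unfold first_above in *; cbn [prec]; rewrite IH by (intros; apply H; lia).
  now rewrite H by lia.
Qed.

Lemma first_above_spec e a k :
  (exists i, i < k /\ 2 * e < a i) ->
  exists i, i < k /\ first_above e a k = a i /\ 2 * e < a i.
Proof.
  unfold first_above; induction k as [|k IH]; intros (i & Hi & H); [lia|].
  set (P := exists i, i < k /\ 2 * e < a i) in *; cbn [prec].
  destruct (classic P) as [HP|HP].
  - destruct (IH HP) as (j & Hj & -> & Hlt); exists j.
    destruct (Nat.eqb_spec (a j) 0); [lia|]; auto.
  - assert (i = k) as ->.
    { destruct (Nat.eq_dec i k); auto; destruct HP; exists i; split; [lia | auto]. }
    assert (Z : forall m, m <= k ->
      prec 0 (fun i r => if r =? 0 then if 2 * e <? a i then a i else 0 else r) m = 0).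
    { induction m as [|m IHm]; intros Hm; [reflexivity|]; cbn [prec].
      rewrite IHm by lia; cbn [Nat.eqb].
      destruct (Nat.ltb_spec (2 * e) (a m)); auto; destruct HP; exists m; split; [lia|auto]. }
    rewrite Z by lia; cbn [Nat.eqb]; exists k.
    destruct (Nat.ltb_spec (2 * e) (a k)); [auto | lia].
Qed.

(** The stage-[s] guess at the number of the class into which the function with index [e] sends
    [pair i 0]; [Nat.pred] undoes the successor in [result]. *)
Definition guess (e i s : nat) : nat := fst' (Nat.pred (approx (HT s) e (pair i 0) s)).
(** Of [2 * e + 2] distinct class numbers, one must exceed [2 * e], as only [2 * e + 1] numbers do
    not. *)
Definition victim (e s : nat) : nat := first_above e (fun i => guess e i s) (2 * e + 2).
(** At stage [s] class [v] receives its element unless it is the current victim of some [e];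
    [2 * e < v] implies [e < v], so the bounded quantifier misses no such [e]. *)
Definition alive (v s : nat) : bool :=
  ball v (fun e => negb ((2 * e <? v) && (victim e s =? v))).

(* As in Post's simple set: the [e]-th limit-computable function makes at most one
   class finite, numbered above [2 * e] and met by that function. *)
Definition PostStr : bstr :=
  BStr (fun z => alive (fst' z) (snd' z)) (fun z z' => fst' z =? fst' z').
Definition AllInf : bstr := BStr (fun _ => true) (fun z z' => fst' z =? fst' z').

Lemma same_fst_equiv U :
  bequiv (BStr U (fun z z' => fst' z =? fst' z')).
Proof.
  split; [|split]; cbn; intros; rewrite ?Nat.eqb_eq in *; congruence.
Qed.

Lemma AllInf_equiv : bequiv AllInf.
Proof. apply same_fst_equiv. Qed.

Lemma PostStr_equiv : bequiv PostStr.
Proof. apply same_fst_equiv. Qed.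

Lemma PostStr_comp : bcomp empty_oracle PostStr.
Proof. split; cbn; unfold alive, victim, first_above, guess; comp. Qed.

Lemma AllInf_comp : bcomp empty_oracle AllInf.
Proof. split; cbn; comp. Qed.

Lemma AllInf_sim z z' : sim AllInf z z' <-> fst' z = fst' z'.
Proof. rewrite sim_iff; cbn; rewrite Nat.eqb_eq; tauto. Qed.

Lemma PostStr_sim z z' :
  sim PostStr z z' <->
  alive (fst' z) (snd' z) = true /\ alive (fst' z') (snd' z') = true /\ fst' z = fst' z'.
Proof. rewrite sim_iff; cbn; rewrite Nat.eqb_eq; tauto. Qed.

Lemma AllInf_inf z : inf AllInf z.
Proof.
  intros s; exists (pair (fst' z) s); split; [generalize (pair_ge (fst' z) s); lia|].
  now rewrite AllInf_sim, fst_pair.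
Qed.

Lemma AllInf_many : Many AllInf (inf AllInf).
Proof.
  intros n; exists (pair (S n) 0); split; [reflexivity|]; split; [apply AllInf_inf|].
  intros y Hy E; apply AllInf_sim in E; rewrite fst_pair in E; generalize (fst_le y); lia.
Qed.

(** If the [n + 2] classes numbered from [n + 1] to [2 * n + 2] were all finite, then at a late
    stage each would be the victim of some [e] with [2 * e < 2 * n + 2]. There are only [n + 1] such
    [e], each with one victim. *)
Lemma PostStr_many : Many PostStr (inf PostStr).
Proof.
  apply NNPP; intros H; apply not_Many in H as [n Hn].
  assert (Hdead : forall i, i < n + 2 ->
    exists t, forall s, t <= s -> alive (n + 1 + i) s = false).
  { intros i Hi; apply NNPP; intros H.
    assert (Ha : forall t, exists s, t <= s /\ alive (n + 1 + i) s = true).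
    { intros t; apply NNPP; intros H'; apply H; exists t; intros s Hs.
      apply not_true_is_false; intros E; apply H'; eauto. }
    destruct (Ha 0) as (s & _ & Hs); set (x := pair (n + 1 + i) s).
    assert (Hx : bu PostStr x = true) by (cbn; unfold x; now rewrite fst_pair, snd_pair).
    destruct (Hn x Hx) as (y & Hy & E).
    - intros t; destruct (Ha t) as (s' & Hs' & E); exists (pair (n + 1 + i) s').
      split; [generalize (pair_ge (n + 1 + i) s'); lia|].
      apply PostStr_sim; unfold x; now rewrite !fst_pair, !snd_pair.
    - apply PostStr_sim in E as (_ & _ & E); unfold x in E; rewrite fst_pair in E.
      generalize (fst_le y); lia. }
  apply eventually_all in Hdead as [t Ht].
  assert (Hk : forall v, In v (seq (n + 1) (n + 2)) ->
    exists e, e < n + 1 /\ victim e t = v).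
  { intros v Hv; apply in_seq in Hv.
    specialize (Ht (v - (n + 1)) ltac:(lia) t (Nat.le_refl _)).
    replace (n + 1 + (v - (n + 1))) with v in Ht by lia.
    apply not_true_iff_false in Ht; unfold alive in Ht; rewrite ball_spec in Ht.
    apply NNPP; intros H; apply Ht; intros e He; apply negb_true_iff.
    apply not_true_is_false; rewrite andb_true_iff, Nat.ltb_lt, Nat.eqb_eq.
    intros [H1 H2]; apply H; exists e; split; [lia | auto]. }
  assert (Hc : incl (seq (n + 1) (n + 2)) (map (fun e => victim e t) (seq 0 (n + 1)))).
  { intros v Hv; destruct (Hk v Hv) as (e & He & <-).
    apply (in_map (fun e => victim e t)), in_seq; lia. }
  apply NoDup_incl_length in Hc; [|apply seq_NoDup].
  rewrite length_map, !length_seq in Hc; lia.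
Qed.

(** Once the first [2 * e + 2] guesses for the embedding have settled, the victim of [e] is a class
    that it really hits. That class gets no more elements, yet it has to contain the image of an
    infinite class. *)
Lemma PostStr_no_embedding :
  ~ O_computable_embedding halting_set (to_es AllInf) (to_es PostStr).
Proof.
  intros (p & f & Hp & Hf).
  destruct (limit_lemma f) as [e He]; [exists p; intros n; now apply Hp|].
  set (c i := fst' (f (pair i 0))).
  assert (Hc : exists i, i < 2 * e + 2 /\ 2 * e < c i).
  { apply NNPP; intros H.
    assert (Hi : incl (map c (seq 0 (2 * e + 2))) (seq 0 (2 * e + 1))).
    { intros v Hv; apply in_map_iff in Hv as (i & <- & Hi); apply in_seq in Hi.
      apply in_seq; assert (~ 2 * e < c i); [|lia].
      intros H'; apply H; exists i; split; [lia | auto]. }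
    apply NoDup_incl_length in Hi; [rewrite length_map, !length_seq in Hi; lia|].
    apply NoDup_map_NoDup_ForallPairs; [|apply seq_NoDup].
    intros i j _ _ E.
    assert (Hs : sim AllInf (pair i 0) (pair j 0)).
    { apply (emb_sim_inv AllInf PostStr f Hf); auto.
      apply PostStr_sim; split; [|split; [|exact E]].
      - exact (emb_univ AllInf PostStr f Hf (pair i 0) eq_refl).
      - exact (emb_univ AllInf PostStr f Hf (pair j 0) eq_refl). }
    apply AllInf_sim in Hs; now rewrite !fst_pair in Hs. }
  destruct (first_above_spec e c (2 * e + 2) Hc) as (i & Hi & E & Hlt).
  assert (Hg : forall i, i < 2 * e + 2 -> exists t, forall s, t <= s -> guess e i s = c i).
  { intros j _; destruct (He (pair j 0)) as [t Ht]; exists t; intros s Hs.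
    unfold guess; now rewrite Ht. }
  apply (eventually_all _ (fun i s => guess e i s = c i)) in Hg as [t Ht].
  assert (Hv : forall s, t <= s -> alive (c i) s = false).
  { intros s Hs; apply not_true_is_false; unfold alive; rewrite ball_spec.
    intros H; specialize (H e ltac:(lia)).
    apply negb_true_iff, not_true_iff_false in H; apply H.
    rewrite andb_true_iff, Nat.ltb_lt, Nat.eqb_eq; split; auto; rewrite <- E.
    apply first_above_ext; intros j Hj; now apply Ht. }
  assert (Hinf := emb_inf AllInf PostStr AllInf_equiv f Hf _ (AllInf_inf (pair i 0))).
  destruct (pair_bound (c i) t) as [m Hm].
  destruct (Hinf m) as (z & Hz & S); apply PostStr_sim in S as (_ & S1 & S2).
  fold (c i) in S2; specialize (Hm z (eq_sym S2)).
  assert (~ t <= snd' z); [|lia].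
  intros Hle; rewrite <- S2, Hv in S1; auto; discriminate.
Qed.

(** * Classification of the structures of degree 0' *)

Theorem degree_classification X :
  bequiv X -> bcomp empty_oracle X ->
  (has_bi_emb_cat_degree (to_es X) halting_set <->
   ~ Many X (inf X) /\ forall m, Many X (fun x => card_ge X x m)).
Proof.
  intros HX CX; split.
  - intros [H1 H2]; split.
    (* With infinitely many infinite classes, [X] is bi-embeddable with both [AllInf] and
       [PostStr]. *)
    + intros HM; apply PostStr_no_embedding.
      destruct (H1 (to_es AllInf) (to_es PostStr)) as [G _]; [| | | |exact G].
      * apply computable_to_es; auto using AllInf_comp, AllInf_equiv.
      * apply computable_to_es; auto using PostStr_comp, PostStr_equiv.
      * split; apply embeds_many_inf;
          auto using PostStr_comp, AllInf_comp, PostStr_equiv, AllInf_equiv, AllInf_many.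
      * split; apply embeds_many_inf;
          auto using PostStr_comp, AllInf_comp, PostStr_equiv, AllInf_equiv, PostStr_many.
    + intros m; apply NNPP; intros Hm.
      assert (Hmin : exists m, ~ Many X (fun x => card_ge X x m) /\
        (m <> 0 -> Many X (fun x => card_ge X x (Nat.pred m)))).
      { induction m as [|m IH]; [exists 0; split; auto; lia|].
        destruct (classic (Many X (fun x => card_ge X x m))) as [H|H]; auto.
        exists (S m); auto. }
      clear m Hm; destruct Hmin as (m & Hm & Hm').
      (* Here the empty oracle computes all embeddings, so leastness of the degree would make the
         halting set decidable. *)
      apply halting_undecidable, H2; intros M N CM CN BM BN.
      apply computable_is_to_es in CM as (B & -> & CB & HB).
      apply computable_is_to_es in CN as (C & -> & CC & HC).
      assert (G : forall B C, bequiv B -> bequiv C -> bcomp empty_oracle B ->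
        bcomp empty_oracle C -> bi_embeddable (to_es B) (to_es X) ->
        bi_embeddable (to_es C) (to_es X) ->
        O_computable_embedding empty_oracle (to_es B) (to_es C)); [|split; apply G; auto].
      clear B C CB HB CC HC BM BN; intros B C HB HC CB CC [[b Hb] _] [_ [c Hc]].
      apply (finite_classes_embedding B C (fun x => c (b x)) m); auto.
      * now apply (emb_comp B X C).
      * intros HM; apply Hm; apply (Many_emb B X b (fun x => card_ge B x m)); auto.
        intros x; now apply emb_card.
      * intros H0; apply (Many_emb X C c (fun x => card_ge X x (Nat.pred m))); auto.
        intros x; now apply emb_card.
  - intros [HM HD]; split; [|intros Y; now apply halting_le_of_categorical].
    intros M N CM CN BM BN.
    apply computable_is_to_es in CM as (B & -> & CB & HB).
    apply computable_is_to_es in CN as (C & -> & CC & HC).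
    assert (G : forall B C, bequiv B -> bequiv C -> bcomp empty_oracle B ->
      bcomp empty_oracle C -> bi_embeddable (to_es B) (to_es X) ->
      bi_embeddable (to_es C) (to_es X) ->
      O_computable_embedding halting_set (to_es B) (to_es C)); [|split; apply G; auto].
    clear B C CB HB CC HC BM BN; intros B C HB HC CB CC [[b Hb] _] [_ [c Hc]].
    apply (halting_embedding B C (fun x => c (b x))); auto.
    + now apply (emb_comp B X C).
    + intros H; apply HM, (Many_emb B X b (inf B)); auto.
      intros x; now apply emb_inf.
    + intros m; apply (Many_emb X C c (fun x => card_ge X x m)); auto.
      intros x; now apply emb_card.
Qed.

(** * The index set is Sigma_4 *)

(** Defined classically, so that it agrees with [C e] even if [phi e] is not total. *)
Definition CStr (e : nat) : bstr :=
  BStr (fun _ => true) (fun x y => classical_bool (phi e (pair x y) 1)).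

Lemma C_to_es e : C e = to_es (CStr e).
Proof.
  unfold C, to_es, CStr; cbn; f_equal.
  - extensionality x; apply propositional_extensionality; tauto.
  - extensionality x; extensionality y; apply propositional_extensionality.
    now rewrite classical_bool_spec.
Qed.

Lemma CStr_sim e x y : sim (CStr e) x y <-> phi e (pair x y) 1.
Proof. rewrite sim_iff; cbn; rewrite classical_bool_spec; tauto. Qed.

Lemma CStr_comp e :
  (forall x y, exists v, phi e (pair x y) v) -> bcomp empty_oracle (CStr e).
Proof.
  intros H; split; cbn; [comp|].
  set (g z := epsilon (inhabits 0) (fun v => phi e z v)).
  assert (Hg : forall z, phi e z (g z)).
  { intros z; apply (epsilon_spec (inhabits 0) (fun v => phi e z v)).
    rewrite <- (pair_eta z); apply H. }
  assert (Cg : Comp empty_oracle g) by (exists (decode e); exact Hg).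
  apply (compB_ext _ (fun z => g z =? 1)); [comp|].
  intros z; apply eq_true_iff_eq; rewrite classical_bool_spec, Nat.eqb_eq, pair_eta.
  split; [intros <-; auto | intros H'; now apply (phi_fun e z)].
Qed.

Lemma index_set_classification e :
  (C_is_structure e /\ has_bi_emb_cat_degree (C e) halting_set) <->
  (forall x y, exists v, phi e (pair x y) v) /\ bequiv (CStr e) /\
  ~ Many (CStr e) (inf (CStr e)) /\ (forall m, Many (CStr e) (fun x => card_ge (CStr e) x m)).
Proof.
  unfold C_is_structure; rewrite C_to_es; fold (bequiv (CStr e)).
  split; intros H; decompose [and] H; rewrite degree_classification in * |- *;
    auto using CStr_comp; tauto.
Qed.

(** The value 2 of [T] stands for output 1. Equivalences seen at a stage are genuine; their absence
    means something only once the computation has halted. *)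
Definition TStr (e t : nat) : bstr :=
  BStr (fun _ => true) (fun x y => T e (pair x y) t =? 2).

Definition halted (e x y t : nat) : bool := negb (T e (pair x y) t =? 0).

Definition laws (e x y z t : nat) : bool :=
  halted e x x t && halted e x y t && halted e y x t && halted e y z t && halted e x z t &&
  simb (TStr e t) x x && (negb (simb (TStr e t) x y) || simb (TStr e t) y x) &&
  (negb (simb (TStr e t) x y && simb (TStr e t) y z) || simb (TStr e t) x z).

Definition large_class (e m n w t : nat) : bool :=
  (m <=? cnt (TStr e t) w t) &&
  ball (S n) (fun y => halted e w y t && negb (simb (TStr e t) w y)).

(** Either an equivalent [y <= a] is visible at stage [t], or no member is at or beyond [k]. Against
    the latter, [d] codes a possible member and a stage at which it would show up. *)
Definition finite_or_old (e a x t k d : nat) : bool :=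
  bex (S a) (fun y => simb (TStr e t) x y) ||
  (fst' d <? k) || negb (simb (TStr e (snd' d)) x (fst' d)).

(** [a] is a bound that every infinite class meets. [b] packs the universal instances: [x, y, z] for
    the laws, [m, n] for the unboundedness. [c] packs a stage, a bound for the class of [x] if it is
    finite, and a large class; [d] tests that bound. *)
Definition matrix (e a b c d : nat) : bool :=
  let x := fst' b in let y := fst' (snd' b) in let z := fst' (snd' (snd' b)) in
  let m := fst' (snd' (snd' (snd' b))) in let n := snd' (snd' (snd' (snd' b))) in
  let t := fst' c in let k := fst' (snd' c) in let w := snd' (snd' c) in
  laws e x y z t && large_class e m n w t && finite_or_old e a x t k d.

Lemma matrix_decidable :
  decidable_set (fun p => matrix (fst' p) (fst' (snd' p)) (fst' (snd' (snd' p)))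
    (fst' (snd' (snd' (snd' p)))) (snd' (snd' (snd' (snd' p)))) = true).
Proof.
  apply (decidable_of_compB _ (fun p => matrix (fst' p) (fst' (snd' p))
    (fst' (snd' (snd' p))) (fst' (snd' (snd' (snd' p)))) (snd' (snd' (snd' (snd' p))))));
    [|reflexivity].
  unfold matrix, laws, large_class, finite_or_old, halted, cnt, simb, TStr; cbn [bu br andb].
  comp.
Qed.

Lemma TStr_sim e t x y : sim (TStr e t) x y <-> T e (pair x y) t = 2.
Proof. rewrite sim_iff; cbn; rewrite Nat.eqb_eq; tauto. Qed.

Lemma TStr_CStr e t x y : sim (TStr e t) x y -> sim (CStr e) x y.
Proof. rewrite TStr_sim, CStr_sim, phi_T; eauto. Qed.

Lemma halted_sim e t x y :
  halted e x y t = true -> simb (TStr e t) x y = simb (CStr e) x y.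
Proof.
  unfold halted; intros H; apply eq_true_iff_eq.
  fold (sim (TStr e t) x y) (sim (CStr e) x y); split; [apply TStr_CStr|].
  rewrite TStr_sim, CStr_sim; intros H'; destruct (T e (pair x y) t) as [|v] eqn:E;
    [discriminate|].
  f_equal; apply (phi_fun e (pair x y)); auto; apply phi_T; eauto.
Qed.

Lemma cnt_sub X Y x s :
  (forall y, y < s -> sim X x y -> sim Y x y) -> cnt X x s <= cnt Y x s.
Proof.
  induction s as [|s IH]; intros H; auto.
  rewrite !cnt_S; assert (cnt X x s <= cnt Y x s) by (apply IH; intros; apply H; auto).
  destruct (simb X x s) eqn:E; [|destruct (simb Y x s); lia].
  rewrite (H s) by auto; lia.
Qed.

Definition eventually (P : nat -> bool) : Prop :=
  exists t, forall s, t <= s -> P s = true.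

Lemma eventually_and P Q : eventually P -> eventually Q -> eventually (fun t => P t && Q t).
Proof.
  intros [t Ht] [t' Ht']; exists (max t t'); intros s Hs.
  rewrite Ht, Ht'; auto; lia.
Qed.

Lemma eventually_impl (P Q : nat -> bool) :
  eventually P -> (forall t, P t = true -> Q t = true) -> eventually Q.
Proof. intros [t Ht] H; exists t; auto. Qed.

Section Total.
Variables (e : nat) (tot : forall x y, exists v, phi e (pair x y) v).

Lemma eventually_halted x y : eventually (halted e x y).
Proof.
  destruct (tot x y) as [v H]; apply phi_T in H as [t Ht]; exists t; intros s Hs.
  unfold halted; now rewrite (T_mono _ _ _ _ _ Ht Hs).
Qed.

Lemma eventually_ball n P :
  (forall y, y < n -> eventually (P y)) -> eventually (fun t => ball n (fun y => P y t)).
Proof.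
  intros H; destruct (eventually_all n (fun y t => P y t = true) H) as [t Ht].
  exists t; intros s Hs; apply ball_spec; intros y Hy; now apply Ht.
Qed.

Lemma eventually_laws x y z : bequiv (CStr e) -> eventually (laws e x y z).
Proof.
  intros HX; unfold laws.
  apply (eventually_impl (fun t => halted e x x t && halted e x y t && halted e y x t &&
    halted e y z t && halted e x z t)).
  - repeat (apply eventually_and); apply eventually_halted.
  - intros t H; rewrite H; rewrite !andb_true_iff in H.
    destruct H as [[[[H1 H2] H3] H4] H5]; rewrite !halted_sim by auto.
    rewrite (sim_refl (CStr e) HX x eq_refl); cbn [andb].
    apply andb_true_iff; split.
    + destruct (simb (CStr e) x y) eqn:E; auto; now apply (sim_sym (CStr e) HX).
    + destruct (simb (CStr e) x y) eqn:E; auto.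
      destruct (simb (CStr e) y z) eqn:E'; auto.
      now apply (sim_trans (CStr e) HX) with y.
Qed.

Lemma eventually_large m n w :
  card_ge (CStr e) w m -> (forall y, y <= n -> ~ sim (CStr e) w y) ->
  eventually (large_class e m n w).
Proof.
  intros [s Hs] Hn; unfold large_class; apply eventually_and.
  - destruct (eventually_ball s (fun y t => halted e w y t)) as [t Ht].
    { intros y _; apply eventually_halted. }
    exists (max s t); intros t' Ht'; apply Nat.leb_le.
    apply Nat.le_trans with (1 := Hs); apply Nat.le_trans with (cnt (TStr e t') w s).
    + apply cnt_sub; intros y Hy E; unfold sim; rewrite halted_sim; auto.
      assert (H := Ht t' ltac:(lia)); rewrite ball_spec in H; auto.
    + apply cnt_mono; lia.
  - apply (eventually_ball (S n) (fun y t => halted e w y t && negb (simb (TStr e t) w y))).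
    intros y Hy; apply (eventually_impl _ _ (eventually_halted w y)).
    intros t H; rewrite H, halted_sim; auto; cbn [andb].
    apply negb_true_iff, not_true_is_false, Hn; lia.
Qed.
End Total.

Lemma index_set_sigma4 :
  Sigma0_4 (fun e => C_is_structure e /\ has_bi_emb_cat_degree (C e) halting_set).
Proof.
  eexists; split; [exact matrix_decidable|]; intros e; cbv beta.
  rewrite index_set_classification; split.
  - intros (tot & HX & HM & HD); apply not_Many in HM as [a Ha]; exists a; intros b.
    set (x := fst' b); set (n := snd' (snd' (snd' (snd' b)))).
    set (m := fst' (snd' (snd' (snd' b)))).
    destruct (HD m n) as (w & _ & Hw & Hwn).
    assert (G : exists k t0, forall t d, t0 <= t -> finite_or_old e a x t k d = true).
    { unfold finite_or_old; destruct (classic (inf (CStr e) x)) as [Hi|Hi].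
      - destruct (Ha x eq_refl Hi) as (y & Hy & E).
        destruct (eventually_halted e tot x y) as [t0 Ht]; exists 0, t0; intros t d Hle.
        apply orb_true_iff; left; apply orb_true_iff; left.
        apply bex_spec; exists y; split; [lia|]; rewrite halted_sim; auto.
      - destruct (not_inf_bound _ _ Hi) as [k Hk]; exists k, 0; intros t d _.
        rewrite <- orb_assoc; apply orb_true_iff; right.
        destruct (Nat.ltb_spec (fst' d) k) as [Hd|Hd]; auto; cbn [orb].
        apply negb_true_iff, not_true_is_false; intros E; apply TStr_CStr in E.
        unfold sim in E; rewrite Hk in E; auto; discriminate. }
    destruct G as (k & t3 & H3).
    destruct (eventually_laws e tot x (fst' (snd' b)) (fst' (snd' (snd' b))) HX) as [t1 H1].
    destruct (eventually_large e tot m n w Hw Hwn) as [t2 H2].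
    (* Each of the three requirements persists at later stages, so one common stage serves them
       all. *)
    exists (pair (t1 + t2 + t3) (pair k w)); intros d.
    repeat rewrite ?fst_pair, ?snd_pair.
    unfold matrix; rewrite !fst_pair, !snd_pair, !fst_pair.
    fold x m n; now rewrite H1, H2, H3 by lia.
  - intros [a H].
    assert (K : forall x y z m n, exists t k w,
      laws e x y z t = true /\ large_class e m n w t = true /\
      forall d, finite_or_old e a x t k d = true).
    { intros x y z m n; destruct (H (pair x (pair y (pair z (pair m n))))) as [c Hc].
      exists (fst' c), (fst' (snd' c)), (snd' (snd' c)).
      assert (Hm : forall d, laws e x y z (fst' c) &&
        large_class e m n (snd' (snd' c)) (fst' c) &&
        finite_or_old e a x (fst' c) (fst' (snd' c)) d = true).
      { intros d; specialize (Hc d); repeat rewrite ?fst_pair, ?snd_pair in Hc.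
        unfold matrix in Hc; repeat rewrite ?fst_pair, ?snd_pair in Hc; exact Hc. }
      assert (H0 := Hm 0); rewrite !andb_true_iff in H0; split; [|split]; try tauto.
      intros d; specialize (Hm d); rewrite !andb_true_iff in Hm; tauto. }
    clear H; split; [|split; [|split]].
    + intros x y; destruct (K x y 0 0 0) as (t & _ & _ & L & _).
      unfold laws in L; rewrite !andb_true_iff in L.
      assert (Hh : halted e x y t = true) by tauto; unfold halted in Hh.
      destruct (T e (pair x y) t) as [|v] eqn:E; [discriminate|].
      exists v; apply phi_T; eauto.
    + assert (L : forall x y z, sim (CStr e) x x /\
        (sim (CStr e) x y -> sim (CStr e) y x) /\
        (sim (CStr e) x y -> sim (CStr e) y z -> sim (CStr e) x z)).
      { intros x y z; destruct (K x y z 0 0) as (t & _ & _ & L & _).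
        unfold laws in L; rewrite !andb_true_iff in L.
        destruct L as [[[[[[[L1 L2] L3] L4] L5] L6] L7] L8].
        rewrite !halted_sim in * by auto; unfold sim.
        destruct (simb (CStr e) x y), (simb (CStr e) y z); cbn [negb orb andb] in *;
          repeat split; auto; discriminate. }
      assert (E : forall x y, br (CStr e) x y = true <-> sim (CStr e) x y).
      { intros x y; rewrite sim_iff; cbn [bu CStr]; tauto. }
      split; [|split]; cbn [es_univ es_rel to_es]; intros x; [|intros y|intros y z];
        intros; apply E;
        repeat match goal with H : br _ _ _ = true |- _ => apply E in H end.
      * apply (proj1 (L x x x)).
      * now apply (proj1 (proj2 (L x y y))).
      * now apply (proj2 (proj2 (L x y z))) .
    + intros HM; destruct (HM a) as (x & _ & Hi & Hx).
      destruct (K x 0 0 0 0) as (t & k & _ & _ & _ & F).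
      destruct (Hi k) as (y & Hy & E); apply CStr_sim, phi_T in E as [s E].
      (* The bound [k] is tested on a member [y] beyond it, at a stage where the equivalence is
         visible. *)
      specialize (F (pair y s)); unfold finite_or_old in F.
      rewrite fst_pair, snd_pair, !orb_true_iff, bex_spec, negb_true_iff in F.
      destruct F as [[(z & Hz & F)|F]|F].
      * apply (Hx z); [lia | now apply TStr_CStr in F].
      * apply Nat.ltb_lt in F; lia.
      * apply not_true_iff_false in F; now apply F, TStr_sim.
    + intros m n; destruct (K 0 0 0 m n) as (t & _ & w & _ & F & _).
      unfold large_class in F; rewrite andb_true_iff, Nat.leb_le, ball_spec in F.
      destruct F as [F1 F2]; exists w; split; [reflexivity|]; split.
      * exists t; apply Nat.le_trans with (1 := F1), cnt_sub.
        intros y _; apply TStr_CStr.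
      * intros y Hy E; specialize (F2 y ltac:(lia)); rewrite andb_true_iff in F2.
        destruct F2 as [F2 F3]; rewrite halted_sim in F3 by auto.
        unfold sim in E; rewrite E in F3; discriminate.
Qed.

(** * Hardness *)

Lemma least_prop (P : nat -> Prop) n :
  P n -> exists m, P m /\ forall k, k < m -> ~ P k.
Proof.
  intros H; destruct (least_true (fun k => classical_bool (P k)) n) as (m & _ & H1 & H2).
  - now apply classical_bool_spec.
  - exists m; split; [now apply classical_bool_spec|].
    intros k Hk HP; apply classical_bool_spec in HP; rewrite H2 in HP; auto; discriminate.
Qed.

Section Hardness.
Variable N : nat -> nat -> nat -> nat -> bool.

(** A finite fragment of: every [a' <= a] has a witness [b < w]. Although [b] may change with [m],
    only finitely many are available, so having the fragment for every [m] with some [t] amounts to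
    the full statement. *)
Definition F (a w m t : nat) : bool :=
  ball (S a) (fun a' => bex w (fun b => ball m (fun c => bex t (N a' b c)))).

Lemma F_spec a w m t :
  F a w m t = true <->
  forall a', a' <= a -> exists b, b < w /\ forall c, c < m -> exists d, d < t /\ N a' b c d = true.
Proof.
  unfold F; rewrite ball_spec; split; intros H a' Ha; specialize (H a' ltac:(lia)).
  - apply bex_spec in H as (b & Hb & H); exists b; split; auto; intros c Hc.
    rewrite ball_spec in H; now apply bex_spec, H.
  - destruct H as (b & Hb & H); apply bex_spec; exists b; split; auto.
    apply ball_spec; intros c Hc; now apply bex_spec, H.
Qed.

Lemma F_mono a w m t w' m' t' :
  F a w m t = true -> w <= w' -> m' <= m -> t <= t' -> F a w' m' t' = true.
Proof.
  rewrite !F_spec; intros H Hw Hm Ht a' Ha; destruct (H a' Ha) as (b & Hb & H').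
  exists b; split; [lia|]; intros c Hc; destruct (H' c ltac:(lia)) as (d & Hd & E).
  exists d; split; auto; lia.
Qed.

(* Keys [pair 0 i] give a class of size [i + 1]. The class with key
   [pair (S a) (pair w m)] is infinite iff [S w] is the least strict bound for
   witnesses [b] of [exists b, forall c, exists d, N a' b c d], all [a' <= a], and
   [m] is the least number refuting the bound [w]; each [c] contributes at most
   one good element [pair c t]. *)
Definition good (x : nat) : bool :=
  let a := Nat.pred (fst' (fst' x)) in
  let w := fst' (snd' (fst' x)) in let m := snd' (snd' (fst' x)) in
  let c := fst' (snd' x) in let t := snd' (snd' x) in
  if fst' (fst' x) =? 0 then snd' x <=? snd' (fst' x)
  else F a (S w) c t && ((t =? 0) || negb (F a (S w) c (Nat.pred t))) &&
       negb (F a w m c) && ((m =? 0) || F a w (Nat.pred m) c).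

(** Numbers that are not good become singletons, since the universe must be all of [nat] as for
    every [C e]. *)
Definition HStr : bstr := BStr (fun _ => true)
  (fun x y => (x =? y) || (good x && good y && (fst' x =? fst' y))).

Lemma HStr_br x y :
  br HStr x y = true <-> x = y \/ good x = true /\ good y = true /\ fst' x = fst' y.
Proof.
  cbn [br HStr]; rewrite orb_true_iff, !andb_true_iff, !Nat.eqb_eq; tauto.
Qed.

Lemma HStr_sim x y :
  sim HStr x y <-> x = y \/ good x = true /\ good y = true /\ fst' x = fst' y.
Proof. rewrite sim_iff, HStr_br; cbn [bu HStr]; tauto. Qed.

Lemma HStr_equiv : bequiv HStr.
Proof.
  split; [|split]; cbn [es_univ es_rel to_es].
  - intros x _; apply HStr_br; auto.
  - intros x y _ _; rewrite !HStr_br; intros [->|(G & G' & E)]; auto.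
  - intros x y z _ _ _; rewrite !HStr_br; intros [->|(G & G' & E)]; auto.
    intros [<-|(G1 & G2 & E')]; auto; right; split; [|split]; congruence.
Qed.

Lemma HStr_fresh n x y : n < fst' x -> y <= n -> ~ sim HStr x y.
Proof.
  intros Hx Hy E; generalize (fst_le y) (fst_le x); apply HStr_sim in E.
  destruct E as [->|(_ & _ & E)]; lia.
Qed.

Lemma HStr_unbounded m : Many HStr (fun x => card_ge HStr x m).
Proof.
  intros n; set (i := m + n + 1); exists (pair (pair 0 i) 0); split; [reflexivity|].
  assert (G : forall j, j <= i -> good (pair (pair 0 i) j) = true).
  { intros j Hj; unfold good; repeat rewrite ?fst_pair, ?snd_pair.
    now apply Nat.leb_le. }
  split.
  - rewrite <- (length_seq m 0), <- (length_map (pair (pair 0 i))); apply card_ge_list.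
    + apply NoDup_map_NoDup_ForallPairs; [|apply seq_NoDup].
      intros a b _ _ E; now apply pair_inj in E.
    + intros y Hy; apply in_map_iff in Hy as (j & <- & Hj); apply in_seq in Hj.
      apply HStr_sim; right; rewrite !fst_pair, !G by lia; auto.
  - intros y Hy; apply HStr_fresh with n; auto; rewrite fst_pair.
    generalize (pair_ge 0 i); lia.
Qed.

Definition inf_key (a w m : nat) : Prop :=
  (forall c, exists t, F a (S w) c t = true) /\ (forall c, F a w m c = false) /\
  (m = 0 \/ exists c, F a w (Nat.pred m) c = true).

Lemma pair_bound2 k l : exists m, forall z, fst' z < k -> snd' z < l -> z < m.
Proof.
  destruct (eventually_all k (fun i m => forall z, fst' z = i -> snd' z < l -> z < m))
    as [m Hm].
  - intros i _; destruct (pair_bound i l) as [m Hm]; exists m; intros s Hs z H1 H2.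
    specialize (Hm z H1 H2); lia.
  - exists m; intros z H1 H2; now apply (Hm (fst' z) H1 m).
Qed.

(** For a fixed key each [c] allows only one good element, as [t] is least for [c]. An infinite
    class thus has good elements with arbitrarily large [c], and monotonicity of [F] turns their
    properties into [inf_key]. *)
Lemma inf_key_of_inf x :
  inf HStr x -> good x = true /\
  exists a w m, fst' x = pair (S a) (pair w m) /\ inf_key a w m.
Proof.
  intros H.
  assert (Hg : forall s, exists y, s <= y /\ good y = true /\ fst' y = fst' x).
  { intros s; destruct (H (s + S x)) as (y & Hy & E); apply HStr_sim in E.
    exists y; split; [lia|]; destruct E as [->|E]; [lia|]; intuition congruence. }
  split.
  { destruct (H (S x)) as (y & Hy & E); apply HStr_sim in E as [->|E]; [lia | tauto]. }
  destruct (fst' (fst' x)) as [|a] eqn:Ea.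
  - exfalso; destruct (pair_bound (fst' x) (S (snd' (fst' x)))) as [m Hm].
    destruct (Hg m) as (y & Hy & Gy & E); specialize (Hm y E).
    unfold good in Gy; rewrite E, Ea in Gy; apply Nat.leb_le in Gy; lia.
  - set (w := fst' (snd' (fst' x))); set (m := snd' (snd' (fst' x))).
    exists a, w, m; split; [unfold w, m; now rewrite pair_eta, <- Ea, pair_eta|].
    assert (Hy : forall y, good y = true -> fst' y = fst' x ->
      F a (S w) (fst' (snd' y)) (snd' (snd' y)) = true /\
      (snd' (snd' y) = 0 \/ F a (S w) (fst' (snd' y)) (Nat.pred (snd' (snd' y))) = false) /\
      F a w m (fst' (snd' y)) = false /\
      (m = 0 \/ F a w (Nat.pred m) (fst' (snd' y)) = true)).
    { intros y Gy E; unfold good in Gy; rewrite E, Ea in Gy; cbn [Nat.eqb Nat.pred] in Gy.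
      rewrite !andb_true_iff, !orb_true_iff, !negb_true_iff, !Nat.eqb_eq in Gy.
      unfold w, m; tauto. }
    assert (Hc : forall k, exists y, k <= fst' (snd' y) /\ good y = true /\ fst' y = fst' x).
    { intros k; apply NNPP; intros Hk.
      destruct (eventually_all k (fun c l => forall t,
        F a (S w) c t = true -> t = 0 \/ F a (S w) c (Nat.pred t) = false -> t < l))
        as [l Hl].
      { intros c _.
        destruct (classic (exists t, F a (S w) c t = true)) as [[t0 Ht0]|Hno].
        - exists (S t0); intros s Hs t Ht [->|Ht']; [lia|].
          assert (~ t0 < t); [|lia]; intros Hlt.
          rewrite (F_mono a (S w) c t0) in Ht'; auto; [discriminate | lia].
        - exists 0; intros s _ t Ht; destruct Hno; eauto. }
      destruct (pair_bound2 k l) as [p Hp], (pair_bound (fst' x) p) as [q Hq].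
      destruct (Hg q) as (y & Hle & Gy & E).
      destruct (Hy y Gy E) as (Y1 & Y2 & _).
      assert (Hlt : fst' (snd' y) < k).
      { apply Nat.nle_gt; intros Hn; apply Hk; eauto. }
      assert (y < q); [|lia]; apply Hq; auto; apply Hp; auto.
      now apply (Hl (fst' (snd' y)) Hlt l). }
    split; [|split].
    + intros c; destruct (Hc c) as (y & Hcy & Gy & E).
      destruct (Hy y Gy E) as (Y1 & _); eexists; apply (F_mono _ _ _ _ _ _ _ Y1); auto.
    + intros c; apply not_true_is_false; intros Hf.
      destruct (Hc c) as (y & Hcy & Gy & E); destruct (Hy y Gy E) as (_ & _ & Y3 & _).
      rewrite (F_mono a w m c) in Y3; auto; discriminate.
    + destruct (Hc 0) as (y & _ & Gy & E); destruct (Hy y Gy E) as (_ & _ & _ & [Y4|Y4]); eauto.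
Qed.

Lemma inf_of_inf_key a w m :
  inf_key a w m -> exists x, inf HStr x /\ fst' x = pair (S a) (pair w m).
Proof.
  intros (K1 & K2 & K3); set (k := pair (S a) (pair w m)).
  assert (Hg : forall s, exists y, s <= y /\ good y = true /\ fst' y = k).
  { intros s.
    (* [c] counts tests for the bound [S w] but is a stage for the bound [w], so it may be enlarged
       until [m - 1] tests succeed for [w]. *)
    assert (Hc : exists c, s <= c /\ (m = 0 \/ F a w (Nat.pred m) c = true)).
    { destruct K3 as [K3|[c K3]]; [eauto|]; exists (s + c); split; [lia|]; right.
      apply (F_mono _ _ _ _ _ _ _ K3); lia. }
    destruct Hc as (c & Hc & Hm); destruct (K1 c) as [t0 Ht0].
    destruct (least_true (F a (S w) c) t0 Ht0) as (t & _ & Ht & Hlt).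
    exists (pair k (pair c t)); split; [|split; [|apply fst_pair]].
    - generalize (pair_ge k (pair c t)) (pair_ge c t); lia.
    - unfold good, k; repeat rewrite ?fst_pair, ?snd_pair; cbn [Nat.eqb Nat.pred].
      rewrite Ht, K2; cbn [negb andb]; rewrite andb_true_r.
      apply andb_true_iff; split; apply orb_true_iff; rewrite Nat.eqb_eq.
      + destruct t; auto; right; rewrite Hlt; auto.
      + exact Hm. }
  destruct (Hg 0) as (x & _ & Gx & Ex); exists x; split; auto; intros s.
  destruct (Hg s) as (y & Hy & Gy & Ey); exists y; split; auto.
  apply HStr_sim; right; rewrite Ey; auto.
Qed.

(** If [w < w'], success of [S w] carries over to [w']; if [m < m'], success on [m' - 1] tests
    includes [m] tests. Either contradicts a refutation. *)
Lemma inf_key_unique a w m w' m' : inf_key a w m -> inf_key a w' m' -> w = w' /\ m = m'.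
Proof.
  assert (Hw : forall w m w' m', inf_key a w m -> inf_key a w' m' -> ~ w < w').
  { clear; intros w m w' m' (K1 & _) (_ & K2 & _) Hlt; destruct (K1 m') as [t Ht].
    specialize (K2 t); rewrite (F_mono a (S w) m' t w' m' t) in K2; auto; discriminate. }
  assert (Hm : forall w m m', inf_key a w m -> inf_key a w m' -> ~ m < m').
  { clear; intros w m m' (_ & K2 & _) (_ & _ & K3) Hlt; destruct K3 as [->|[c K3]]; [lia|].
    specialize (K2 c); rewrite (F_mono a w (Nat.pred m') c w m c) in K2; auto; [discriminate | lia]. }
  intros H H'; assert (w = w') as <-.
  { apply Nat.le_antisymm; apply Nat.nlt_ge; [exact (Hw _ _ _ _ H' H) | exact (Hw _ _ _ _ H H')]. }
  split; auto.
  apply Nat.le_antisymm; apply Nat.nlt_ge; [exact (Hm _ _ _ H' H) | exact (Hm _ _ _ H H')].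
Qed.

Lemma HStr_many_inf :
  (forall a, exists b, forall c, exists d, N a b c d = true) -> Many HStr (inf HStr).
Proof.
  intros H n; set (Good w := forall c, exists t, F n w c t = true).
  assert (HG : exists w, Good w).
  { destruct (eventually_all (S n)
      (fun a w => exists b, b < w /\ forall c, exists d, N a b c d = true)) as [w Hw].
    { intros a _; destruct (H a) as [b Hb]; exists (S b); intros s Hs; eauto. }
    exists w; intros m.
    destruct (eventually_all (S n) (fun a t => exists b, b < w /\
      forall c, c < m -> exists d, d < t /\ N a b c d = true)) as [t Ht].
    { intros a Ha; destruct (Hw a Ha w (Nat.le_refl _)) as (b & Hb & Hc).
      destruct (eventually_all m (fun c t => exists d, d < t /\ N a b c d = true)) as [t Ht].
      - intros c _; destruct (Hc c) as [d Hd]; exists (S d); intros s Hs; eauto.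
      - exists t; intros s Hs; exists b; auto. }
    exists t; apply F_spec; intros a Ha; apply (Ht a); lia. }
  destruct HG as [w0 Hw0]; destruct (least_prop Good w0 Hw0) as ([|w] & Hw & Hmin).
  (* The bound 0 leaves no candidate [b], so the least bound is a successor. *)
  { destruct (Hw 0) as [t Ht]; rewrite F_spec in Ht.
    destruct (Ht 0) as (b & Hb & _); lia. }
  assert (Hbad : exists m, ~ exists t, F n w m t = true).
  { apply NNPP; intros Hb; apply (Hmin w); auto; intros c; apply NNPP; eauto. }
  destruct Hbad as [m0 Hm0].
  destruct (least_prop (fun m => ~ exists t, F n w m t = true) m0 Hm0) as (m & Hm & Hm').
  assert (K : inf_key n w m).
  { split; [exact Hw|]; split.
    - intros c; apply not_true_is_false; eauto.
    - destruct m as [|m]; auto; right; apply NNPP, Hm'; simpl; lia. }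
  destruct (inf_of_inf_key _ _ _ K) as (x & Hx & E); exists x; split; [reflexivity|].
  split; auto; intros y Hy; apply HStr_fresh with n; auto; rewrite E.
  generalize (pair_ge (S n) (pair w m)); lia.
Qed.

(** For [a >= a0] every bound fails, since each of its finitely many candidates is refuted for [a0].
    The infinite classes thus have [a < a0], and [inf_key_unique] leaves at most one for each. *)
Lemma HStr_not_many_inf a0 :
  (forall b, exists c, forall d, N a0 b c d = false) -> ~ Many HStr (inf HStr).
Proof.
  intros H HM.
  assert (Ha : forall a w m, inf_key a w m -> a < a0).
  { intros a w m (K1 & _ & _); apply Nat.nle_gt; intros Hle.
    destruct (eventually_all (S w)
      (fun b k => exists c, c < k /\ forall d, N a0 b c d = false)) as [k Hk].
    { intros b _; destruct (H b) as [c Hc]; exists (S c); intros s Hs; eauto. }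
    destruct (K1 k) as [t Ht]; rewrite F_spec in Ht; destruct (Ht a0 Hle) as (b & Hb & Hc).
    destruct (Hk b Hb k (Nat.le_refl _)) as (c & Hck & Hd).
    destruct (Hc c Hck) as (d & _ & E); rewrite Hd in E; discriminate. }
  destruct (eventually_all a0 (fun a n => forall x, inf HStr x -> fst' (fst' x) = S a ->
    exists y, y <= n /\ sim HStr x y)) as [n Hn].
  { intros a _.
    destruct (classic (exists x, inf HStr x /\ fst' (fst' x) = S a)) as [(x & Hx & Ex)|Hno].
    - exists x; intros s Hs z Hz Ez; exists x; split; auto.
      destruct (inf_key_of_inf x Hx) as (Gx & a1 & w & m & E1 & K1).
      destruct (inf_key_of_inf z Hz) as (Gz & a2 & w' & m' & E2 & K2).
      rewrite E1, fst_pair in Ex; rewrite E2, fst_pair in Ez.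
      injection Ex as ->; injection Ez as ->.
      destruct (inf_key_unique _ _ _ _ _ K1 K2) as [-> ->].
      apply HStr_sim; right; rewrite E1; auto.
    - exists 0; intros s _ x Hx Ex; destruct Hno; eauto. }
  destruct (HM n) as (x & _ & Hx & Hy).
  destruct (inf_key_of_inf x Hx) as (_ & a & w & m & E & K).
  destruct (Hn a (Ha _ _ _ K) n (Nat.le_refl _) x Hx) as (y & Hyn & S).
  - now rewrite E, fst_pair.
  - now apply (Hy y).
Qed.
End Hardness.

Theorem theorem4p5 :
  Sigma0_4_complete
    (fun e => C_is_structure e /\ has_bi_emb_cat_degree (C e) halting_set).
Proof.
  split; [exact index_set_sigma4|].
  intros S (R & HR & HS).
  apply compB_of_decidable in HR as (r & Cr & Er).
  (* With the negated matrix, membership in [S] is the failure of [forall a, exists b, forall c,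
     exists d, N], that is, finiteness of the number of infinite classes. *)
  set (N n a b c d := negb (r (pair n (pair a (pair b (pair c d)))))).
  assert (CH : Comp empty_oracle (fun z =>
    Nat.b2n (br (HStr (N (fst' z))) (fst' (snd' z)) (snd' (snd' z))))).
  { unfold HStr, good, F, N; cbn [br]; comp. }
  destruct CH as [p Hp].
  assert (E : forall n, CStr (smn p n) = HStr (N n)).
  { intros n; unfold CStr, HStr at 1; f_equal.
    extensionality x; extensionality y.
    specialize (Hp (pair n (pair x y))); rewrite !fst_pair, !snd_pair, fst_pair in Hp.
    change (classical_bool (phi (smn p n) (pair x y) 1) = br (HStr (N n)) x y).
    apply eq_true_iff_eq; rewrite classical_bool_spec, phi_smn.
    destruct (br (HStr (N n)) x y); split; auto; [|discriminate].
    intros H; assert (H' := eval_fun _ _ _ _ H Hp); discriminate. }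
  exists (smn p); split.
  { destruct (comp_smn empty_oracle p _ (comp_id _)) as [q Hq]; now exists q. }
  intros n; rewrite index_set_classification, E, HS; split.
  - intros [a Ha]; split; [|split; [apply HStr_equiv|split; [|apply HStr_unbounded]]].
    + intros x y; eexists; apply phi_smn, Hp.
    + apply (HStr_not_many_inf (N n) a); intros b; destruct (Ha b) as [c Hc]; exists c.
      intros d; apply negb_false_iff, Er, Hc.
  - intros (_ & _ & HM & _); apply NNPP; intros Hn; apply HM, HStr_many_inf; intros a.
    apply NNPP; intros Hb; apply Hn; exists a; intros b.
    apply NNPP; intros Hc; apply Hb; exists b; intros c.
    apply NNPP; intros Hd; apply Hc; exists c; intros d.
    apply NNPP; intros Hr; apply Hd; exists d; apply negb_true_iff, not_true_is_false.
    now rewrite Er.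
Qed.
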